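(* Consider either the pair ($\Phi_\lambda=\Phi_{+,\lambda}$, $\Psi_\mu=\Psi_{+,\mu}$) or the pair ($\Phi_\lambda=\Phi_{0,\lambda}$, $\Psi_\mu=\Psi_{0,\mu}$), with arbitrary $\lambda,\mu>0$. (i) Let $x^*$ be a local minimizer of (P) with $F(x^* )<\infty$, let $J_*=\{i:(Bx^*-b)_i\ne0\}$, $\bar J_*=[r]\setminus J_*$, and suppose $\{x: x\in\operatorname{ri}(\operatorname{dom}f),\ Ax\in\operatorname{ri}(\operatorname{dom}g),\ (Bx-b)_{\bar J_*}\le0\}\ne\emptyset$ (in the $\Phi_{+,\lambda}$ case), resp. $\{x: x\in\operatorname{ri}(\operatorname{dom}f),\ Ax\in\operatorname{ri}(\operatorname{dom}g),\ (Bx-b)_{\bar J_*}=0\}\ne\emptyset$ (in the $\Phi_{0,\lambda}$ case). Then there exist $y^*\in\partial g(Ax^* )$ and $z^*\in\partial\Phi_\lambda(Bx^*-b)$ such that $w^*=[y^*;z^*]$ is a local minimizer of (D), and $\Theta(x^* )=-\Xi(w^* )$. (ii) Let $w^*=[y^*;z^*]$ be a local minimizer of (D) with $G(w^* )<\infty$, let $T_*=\{i:z^*_i\ne0\}$, $\bar T_*=[r]\setminus T_*$, and suppose $\{w=[y;z]: -A^\top y-B^\top z\in\operatorname{ri}(\operatorname{dom}f^* ),\ y\in\operatorname{ri}(\operatorname{dom}g^* ),\ z_{\bar T_*}=0,\ z_{T_*}\ge0\}\ne\emptyset$ (in the $\Psi_{+,\mu}$ case), resp. the same set without the constraint $z_{T_*}\ge0$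 (in the $\Psi_{0,\mu}$ case). Then there exists $x^*\in\partial f^*(-A^\top y^*-B^\top z^* )$ that is a local minimizer of (P), and $\Theta(x^* )=-\Xi(w^* )$. In all Slater-type conditions, ''$\operatorname{ri}$'' may be omitted for a function that is polyhedral.
   Context: Let $f:\mathbb R^n\to(-\infty,\infty]$, $g:\mathbb R^m\to(-\infty,\infty]$ be proper, lsc and convex with conjugates $f^*(q)=\sup_x\{\langle q,x\rangle-f(x)\}$, $g^*$; $A\in\mathbb R^{m\times n}$, $B\in\mathbb R^{r\times n}$, $b\in\mathbb R^r$. $\Phi_{0,\lambda}(u)=\sum_i\lambda_i\mathbf 1_{\{u_i\ne0\}}$, $\Phi_{+,\lambda}(u)=\sum_i\lambda_i\mathbf 1_{\{u_i>0\}}$, $\Psi_{0,\mu}(z)=\sum_i\mu_i\mathbf 1_{\{z_i\ne0\}}$, $\Psi_{+,\mu}(z)=\Psi_{0,\mu}(z)+\delta(z\mid\mathbb R^r_+)$. $\Theta(x)=f(x)+g(Ax)$; (P) is $\min_x F(x)=\Theta(x)+\Phi_\lambda(Bx-b)$. For $w=[y;z]\in\mathbb R^m\times\mathbb R^r$, $\Xi(w)=f^*(-A^\top y-B^\top z)+g^*(y)+\langle b,z\rangle$; (D) is $\min_w G(w)=\Xi(w)+\Psi_\mu(z)$. $\partial$ denotes the limiting subdifferential (convex subdifferential for convex functions); $\partial\Phi_{0,\lambda}(u)=\{z:z_i\in\mathbb R\text{ if }u_i=0,\ z_i=0\text{ otherwise}\}$, $\partial\Phi_{+,\lambda}(u)=\{z:z_i\in\mathbb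 R_+\text{ if }u_i=0,\ z_i=0\text{ otherwise}\}$. $\operatorname{ri}$ denotes relative interior. *)

(* Defs.v *)
From HB Require Import structures.
From mathcomp Require Import all_boot all_order all_algebra.
From mathcomp Require Import all_classical all_reals ereal.
Set Implicit Arguments. Unset Strict Implicit. Unset Printing Implicit Defensive.
Import Order.TTheory GRing.Theory Num.Theory.
Local Open Scope ring_scope.
Local Open Scope classical_set_scope.

Section ConvexDefs.
Variable R : realType.

Definition dotv {n : nat} (u v : 'cV[R]_n) : R := \sum_(i < n) u i 0 * v i 0.

Definition near_in {n : nat} (d : R) (x x' : 'cV[R]_n) : Prop :=
  forall i, `|x' i 0 - x i 0| < d.

Definition edom {n : nat} (f : 'cV[R]_n -> \bar R) : set 'cV[R]_n :=
  [set x | (f x < +oo)%E].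

Definition proper_fun {n : nat} (f : 'cV[R]_n -> \bar R) : Prop :=
  (forall x, f x != -oo%E) /\ (exists x, (f x < +oo)%E).

(* convexity (of the epigraph) *)
Definition convex_fun {n : nat} (f : 'cV[R]_n -> \bar R) : Prop :=
  forall (x y : 'cV[R]_n) (a c t : R), (f x <= a%:E)%E -> (f y <= c%:E)%E ->
    0 <= t -> t <= 1 ->
    (f (t *: x + (1 - t) *: y)%R <= (t * a + (1 - t) * c)%R%:E)%E.

Definition lsc_fun {n : nat} (f : 'cV[R]_n -> \bar R) : Prop :=
  forall (x : 'cV[R]_n) (a : R), (a%:E < f x)%E ->
    exists2 d : R, 0 < d & forall y, near_in d x y -> (a%:E < f y)%E.

Definition conj_fun {n : nat} (f : 'cV[R]_n -> \bar R) (q : 'cV[R]_n) : \bar R :=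
  ereal_sup [set ((dotv q x)%:E - f x)%E | x in [set: 'cV[R]_n]].

Definition csubdiff {n : nat} (f : 'cV[R]_n -> \bar R) (x : 'cV[R]_n)
  : set 'cV[R]_n :=
  [set v | f x \is a fin_num /\
           forall y, (f x + (dotv v (y - x)%R)%:E <= f y)%E].

Definition aff_hull {n : nat} (C : set 'cV[R]_n) : set 'cV[R]_n :=
  [set y | exists (k : nat) (p : 'I_k -> 'cV[R]_n) (c : 'I_k -> R),
     [/\ forall j, C (p j), \sum_(j < k) c j = 1 & y = \sum_(j < k) c j *: p j]].

Definition relint {n : nat} (C : set 'cV[R]_n) : set 'cV[R]_n :=
  [set x | C x /\ exists2 e : R, 0 < e &
     forall y, aff_hull C y -> near_in e x y -> C y].

(* polyhedral convex function: proper, with epigraph a polyhedral set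
   (finite intersection of closed half-spaces of R^n x R) *)
Definition polyhedral_fun {n : nat} (f : 'cV[R]_n -> \bar R) : Prop :=
  proper_fun f /\
  exists (k : nat) (a : 'I_k -> 'cV[R]_n) (c d : 'I_k -> R),
    forall x (t : R), (f x <= t%:E)%E <-> (forall j, dotv (a j) x + c j * t <= d j).

Definition slater_pt {n : nat} (f : 'cV[R]_n -> \bar R) (x : 'cV[R]_n) : Prop :=
  relint (edom f) x \/ (polyhedral_fun f /\ edom f x).

(* Phi_{+,lam} (pos = true) and Phi_{0,lam} (pos = false) *)
Definition Phi {r : nat} (pos : bool) (lam : 'I_r -> R) (u : 'cV[R]_r) : R :=
  \sum_(i < r) (if (if pos then 0 < u i 0 else u i 0 != 0) then lam i else 0).

(* Psi_{+,mu} (pos = true) and Psi_{0,mu} (pos = false) *)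
Definition Psi {r : nat} (pos : bool) (mu : 'I_r -> R) (z : 'cV[R]_r) : \bar R :=
  if pos && ~~ [forall i, 0 <= z i 0] then +oo%E
  else (\sum_(i < r) (if z i 0 != 0 then mu i else 0))%:E.

(* limiting subdifferential of Phi, as given in the paper *)
Definition subdiffPhi {r : nat} (pos : bool) (u : 'cV[R]_r) : set 'cV[R]_r :=
  [set z | forall i, if u i 0 == 0 then (pos ==> (0 <= z i 0)) else z i 0 == 0].

Definition Theta {n m : nat} (f : 'cV[R]_n -> \bar R) (g : 'cV[R]_m -> \bar R)
  (A : 'M[R]_(m, n)) (x : 'cV[R]_n) : \bar R := (f x + g (A *m x))%E.

Definition Fobj {n m r : nat} (f : 'cV[R]_n -> \bar R) (g : 'cV[R]_m -> \bar R)
  (A : 'M[R]_(m, n)) (B : 'M[R]_(r, n)) (b : 'cV[R]_r) (pos : bool)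
  (lam : 'I_r -> R) (x : 'cV[R]_n) : \bar R :=
  (Theta f g A x + (Phi pos lam (B *m x - b))%:E)%E.

Definition Xi {n m r : nat} (f : 'cV[R]_n -> \bar R) (g : 'cV[R]_m -> \bar R)
  (A : 'M[R]_(m, n)) (B : 'M[R]_(r, n)) (b : 'cV[R]_r)
  (y : 'cV[R]_m) (z : 'cV[R]_r) : \bar R :=
  (conj_fun f (- (A^T *m y) - B^T *m z)%R + conj_fun g y + (dotv b z)%:E)%E.

Definition Gobj {n m r : nat} (f : 'cV[R]_n -> \bar R) (g : 'cV[R]_m -> \bar R)
  (A : 'M[R]_(m, n)) (B : 'M[R]_(r, n)) (b : 'cV[R]_r) (pos : bool)
  (mu : 'I_r -> R) (y : 'cV[R]_m) (z : 'cV[R]_r) : \bar R :=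
  (Xi f g A B b y z + Psi pos mu z)%E.

Definition local_min {n : nat} (F : 'cV[R]_n -> \bar R) (x : 'cV[R]_n) : Prop :=
  exists2 d : R, 0 < d & forall x', near_in d x x' -> (F x <= F x')%E.

Definition local_min2 {m r : nat} (G : 'cV[R]_m -> 'cV[R]_r -> \bar R)
  (y : 'cV[R]_m) (z : 'cV[R]_r) : Prop :=
  exists2 d : R, 0 < d & forall y' z', near_in d y y' -> near_in d z z' ->
    (G y z <= G y' z')%E.

End ConvexDefs.

(* Main.v *)
(**
  A local minimizer of (P) minimizes the convex function [Theta] over the
  polyhedron obtained by freezing the constraints active at that point, and a
  local minimizer of (D) minimizes the convex function [Xi] over the subspace
  given by its support. Both are convex problems with a mixed polyhedral Slater
  condition, so Lagrange multipliers exist, and they are the points sought on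
  the other side. Local optimality there follows from weak duality coordinate
  by coordinate: leaving the frozen pattern costs a fixed positive weight.

  The multipliers come from a purely algebraic theorem on a convex set [D] cut
  out by affine inequalities, with a feasible point in the algebraic relative
  interior of [D]; constraints are eliminated one at a time by a supremum in
  the real line. Functions satisfying the relative-interior condition put their
  epigraph into [D], polyhedral ones contribute affine inequalities.
  Fenchel-Moreau is obtained from the same theorem, by separating [(p, a)] with
  [a < f p] from the epigraph thickened by the box on which [f > a].
*)

Require Import Defs.
From HB Require Import structures.
From mathcomp Require Import all_boot all_order all_algebra.
From mathcomp Require Import all_classical all_reals ereal.
From mathcomp Require Import ring lra.
Import Order.TTheory GRing.Theory Num.Theory.
Local Open Scope ring_scope.

(** * Lagrange multipliers for affine constraints on a convex set *)

Section Multipliers.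
Set Implicit Arguments. Unset Strict Implicit.
Variables (R : realType) (W : lmodType R).
Implicit Types (D : W -> Prop) (a q : W -> R).

Definition affine_fun a := forall (t : R) x y,
  a (t *: x + (1 - t) *: y) = t * a x + (1 - t) * a y.

Definition convex_pred D := forall (t : R) x y,
  D x -> D y -> 0 <= t -> t <= 1 -> D (t *: x + (1 - t) *: y).

(* For convex [D] in finite dimension this is the relative interior. *)
Definition icore D x := D x /\
  forall y, D y -> exists2 e : R, 1 < e & D (e *: x + (1 - e) *: y).

Lemma affine_fun_sum (I : finType) (S : {set I}) (a : I -> W -> R) (l : I -> R) :
  (forall i, affine_fun (a i)) -> affine_fun (fun x => \sum_(i in S) l i * a i x).
Proof.
move=> ha t x y; rewrite !mulr_sumr -big_split /=.
by apply: eq_bigr => i _; rewrite ha; ring.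
Qed.

Lemma affine_funD a1 a2 :
  affine_fun a1 -> affine_fun a2 -> affine_fun (fun x => a1 x + a2 x).
Proof. by move=> h1 h2 t x y; rewrite h1 h2; ring. Qed.

Lemma affine_funZ (l : R) a : affine_fun a -> affine_fun (fun x => l * a x).
Proof. by move=> h t x y; rewrite h; ring. Qed.

Lemma affine_fun_cst (c : R) : affine_fun (fun=> c).
Proof. by move=> t x y; ring. Qed.

(** The segment from [y] through [x] can be prolonged inside [D]; a positive value at [y] would make
    [a] negative beyond [x]. *)
Lemma affine_icore_eq0 D x a : icore D x -> affine_fun a ->
  (forall y, D y -> 0 <= a y) -> a x <= 0 -> forall y, D y -> a y = 0.
Proof.
move=> [Dx hD] ha a0 ax y Dy; have [e e1 De] := hD y Dy.
have := a0 _ De; rewrite ha => h; have := a0 _ Dy; have := a0 _ Dx => *; nra.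
Qed.

Lemma convex_mix D a x y : convex_pred D -> affine_fun a -> D x -> D y ->
  a x < 0 -> 0 < a y ->
  exists t, [/\ 0 < t, t < 1, D (t *: x + (1 - t) *: y) & t * a x + (1 - t) * a y = 0].
Proof.
move=> cD ha Dx Dy ax ay; have h : 0 < a y - a x by lra.
have h0 : a y - a x != 0 by rewrite gt_eqF.
exists (a y / (a y - a x)); have t0 : 0 < a y / (a y - a x) by apply: divr_gt0.
have t1 : a y / (a y - a x) < 1 by rewrite ltr_pdivrMr//; lra.
split=> //; first by apply: cD => //; apply: ltW.
by field.
Qed.

(** Points with [a > 0] bound the multiplier below by [- q / a], points with [a < 0] bound it above
    by [q / - a]. These bounds are compatible because a mixture of two such points is a zero of [a],
    where [q >= 0]; the supremum of the lower bounds therefore works. *)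
Lemma ineq_multiplier D q a x1 : convex_pred D -> affine_fun q -> affine_fun a ->
  (forall x, D x -> a x <= 0 -> 0 <= q x) -> D x1 -> a x1 < 0 ->
  exists2 l : R, 0 <= l & forall x, D x -> 0 <= q x + l * a x.
Proof.
move=> cD hq ha h Dx1 ax1.
(* Adjoining 0 makes [X] nonempty and its supremum nonnegative. *)
pose X : set R :=
  [set l | l = 0 \/ exists x, [/\ D x, 0 < a x & l * a x = - q x]]%classic.
have ub z : D z -> a z < 0 -> forall l, X l -> l * - a z <= q z.
  move=> Dz az l [->|[x [Dx ax el]]]; first by rewrite mul0r h// ltW.
  have [t [t0 t1 Dt et]] := @convex_mix D a z x cD ha Dz Dx az ax.
  have := h _ Dt; rewrite hq ha et lexx => /(_ isT) hh.
  have {}hh : 0 <= t * q z - (1 - t) * (l * a x) by rewrite el; lra.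
  have e2 : (1 - t) * a x = - (t * a z) by lra.
  have {}hh : 0 <= t * (q z + l * a z).
    by move: hh; rewrite mulrCA e2 => hh; lra.
  by rewrite pmulr_rge0// in hh; lra.
have hX : has_sup X.
  split; first by exists 0; left.
  exists (q x1 / - a x1) => l /(ub _ Dx1 ax1); rewrite ler_pdivlMr//; lra.
exists (sup X); first by apply: ub_le_sup; [case: hX|left].
move=> x Dx; have [ax|ax|ax] := ltgtP (a x) 0.
- suff : sup X <= q x / - a x by rewrite ler_pdivlMr; lra.
  apply: ge_sup; first by case: hX.
  by move=> l /(ub _ Dx ax); rewrite ler_pdivlMr//; lra.
- suff : - q x / a x <= sup X by rewrite ler_pdivrMr//; lra.
  apply: ub_le_sup; first by case: hX.
  by right; exists x; split=> //; rewrite divfK// gt_eqF.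
- by rewrite ax mulr0 addr0 h// ax.
Qed.

(** Unless [a] vanishes on [D], the core condition yields points where [a] has both strict signs;
    the equation can then be relaxed to one of the two inequalities, which has a strict Slater
    point. *)
Lemma eq_multiplier D q a x : convex_pred D -> affine_fun q -> affine_fun a ->
  icore D x -> a x = 0 -> (forall y, D y -> a y = 0 -> 0 <= q y) ->
  exists l : R, forall y, D y -> 0 <= q y + l * a y.
Proof.
move=> cD hq ha xD ax h.
have [h0|/existsNP[x1 /not_implyP[Dx1 /eqP ax1]]] := pselect (forall y, D y -> a y = 0).
  by exists 0 => y Dy; rewrite mul0r addr0 h// h0.
have [e e1 De] := xD.2 _ Dx1.
have ae : a (e *: x + (1 - e) *: x1) = (1 - e) * a x1 by rewrite ha ax; ring.
wlog ax1n : a ha ax h ax1 ae / a x1 < 0.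
  move=> H; have [|a0|a0] := ltgtP (a x1) 0; [exact: H| |by rewrite a0 eqxx in ax1].
  have [| | | | | |l hl] := H (fun y => -1 * a y).
  - exact: affine_funZ.
  - by rewrite ax mulr0.
  - by move=> y Dy e0; apply: h => //; lra.
  - by rewrite mulN1r oppr_eq0.
  - by rewrite ae; ring.
  - by lra.
  by exists (- l) => y /hl; lra.
have ae0 : 0 < a (e *: x + (1 - e) *: x1) by rewrite ae; nra.
(* If [q] were negative somewhere on each side of [a = 0], a mixture of two such points would be a
   zero of [a] with [q < 0]. *)
have [hn|/existsNP[y /not_implyP[Dy /not_implyP[ay /negP qy]]]] :=
    pselect (forall y, D y -> a y <= 0 -> 0 <= q y).
  have [l _ hl] := @ineq_multiplier D q a x1 cD hq ha hn Dx1 ax1n.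
  by exists l.
have [|||l _ hl] := @ineq_multiplier D q (fun y => -1 * a y) _ cD hq _ _ De.
- exact: affine_funZ.
- move=> z Dz az; rewrite leNgt; apply/negP => qz; rewrite -ltNge in qy.
  have {}ay : a y < 0.
    by rewrite lt_neqAle ay andbT; apply/negP => /eqP /(h _ Dy); rewrite leNgt qy.
  have {}az : 0 < a z.
    rewrite lt_neqAle; apply/andP; split; last by lra.
    by apply/negP => /eqP /esym /(h _ Dz); rewrite leNgt qz.
  have [t [t0 t1 Dt et]] := @convex_mix D a y z cD ha Dy Dz ay az.
  have := h _ Dt; rewrite hq ha et => /(_ erefl); nra.
- lra.
by exists (- l) => z /hl; lra.
Qed.

Lemma icore_slice D x (P : W -> Prop) : icore D x -> P x ->
  (forall e y, P y -> P (e *: x + (1 - e) *: y)) -> icore (fun y => D y /\ P y) x.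
Proof.
move=> [Dx h] Px hP; split=> // y [Dy Py]; have [e e1 De] := h y Dy.
by exists e => //; split=> //; apply: hP.
Qed.

Lemma convex_predI D (P : W -> Prop) : convex_pred D ->
  convex_pred P -> convex_pred (fun y => D y /\ P y).
Proof. by move=> hD hP t x y [Dx Px] [Dy Py] t0 t1; split; [apply: hD|apply: hP]. Qed.

(** One equation is absorbed into the convex set, and [x] stays in the core because it solves that
    equation. Its multiplier is found last, with the Lagrangian of the other equations as
    objective. *)
Lemma eq_multipliers (I : finType) (a : I -> W -> R) (E : {set I}) D q x :
  (forall i, affine_fun (a i)) -> convex_pred D -> affine_fun q ->
  icore D x -> (forall i, i \in E -> a i x = 0) ->
  (forall y, D y -> (forall i, i \in E -> a i y = 0) -> 0 <= q y) ->
  exists l : I -> R, forall y, D y -> 0 <= q y + \sum_(i in E) l i * a i y.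
Proof.
move=> ha; have [k] := ubnP #|E|; elim: k => // k IH in E D q *.
move=> hk cD hq xD ax h.
have [E0|[m mE]] := set_0Vmem E.
  exists (fun=> 0) => y Dy; rewrite E0 big_set0 addr0 h// => i.
  by rewrite E0 inE.
pose D' y := D y /\ a m y = 0.
have cm : convex_pred (fun y => a m y = 0).
  by move=> t y z y0 z0 _ _; rewrite ha y0 z0 !mulr0 addr0.
have [|||||| l hl] := IH (E :\ m) D' q.
- by rewrite (cardsD1 m) mE in hk.
- exact: convex_predI.
- exact: hq.
- apply: icore_slice => //; first exact: ax.
  by move=> e y y0; rewrite ha y0 (ax m mE) !mulr0 addr0.
- by move=> i /setD1P[_ iE]; apply: ax.
- move=> y [Dy am] h'; apply: h => // i iE.
  by have [->//|im] := eqVneq i m; apply: h'; rewrite !inE im.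
have [|||||l' hl'] := @eq_multiplier D (fun y => q y + \sum_(i in E :\ m) l i * a i y) (a m) x cD.
- by apply: affine_funD => //; apply: affine_fun_sum.
- by [].
- by [].
- exact: ax.
- by move=> y Dy am; apply: hl; split.
exists (fun i => if i == m then l' else l i) => y Dy.
rewrite (bigD1 m)//= eqxx addrCA addrC.
rewrite [X in _ + X + _](_ : _ = \sum_(i in E :\ m) l i * a i y).
  exact: hl'.
apply: eq_big => [i|i /andP[_ /negbTE->]//]; by rewrite !inE andbC.
Qed.

(* If some point satisfying the other constraints has [a m < 0], a single
   multiplier disposes of [m]. Otherwise the induction hypothesis applied to
   [a m] itself makes [a m] a nonpositive combination of the other constraints
   on [D]; the constraints involved are then implicit equalities, whose
   multipliers may be shifted by that combination to become nonnegative. *)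
Lemma ineq_multipliers (I : finType) (a : I -> W -> R) (S : {set I}) D q x :
  (forall i, affine_fun (a i)) -> convex_pred D -> affine_fun q ->
  icore D x -> (forall i, i \in S -> a i x <= 0) ->
  (forall y, D y -> (forall i, i \in S -> a i y <= 0) -> 0 <= q y) ->
  exists2 l : I -> R, (forall i, 0 <= l i) &
    forall y, D y -> 0 <= q y + \sum_(i in S) l i * a i y.
Proof.
move=> ha; have [k] := ubnP #|S|; elim: k => // k IH in S D q *.
move=> hk cD hq xD ax h.
have [S0|[m mS]] := set_0Vmem S.
  exists (fun=> 0) => // y Dy; rewrite S0 big_set0 addr0 h// => i.
  by rewrite S0 inE.
have hS (P : pred I) : P m -> (forall i, i \in S :\ m -> P i) -> forall i, i \in S -> P i.
  move=> Pm P' i iS; have [->//|im] := eqVneq i m.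
  by apply: P'; rewrite !inE im.
have hk' : (#|S :\ m| < k)%N by rewrite (cardsD1 m) mS in hk.
pose C y := forall i, i \in S :\ m -> a i y <= 0.
have cC : convex_pred C.
  by move=> t y z Cy Cz t0 t1 i iS; rewrite ha; have := Cy i iS; have := Cz i iS; nra.
have [[x1 [Dx1 Cx1 ax1]]|hn] := pselect (exists y, [/\ D y, C y & a m y < 0]).
  have [||l0 l00 hl0] := @ineq_multiplier (fun y => D y /\ C y) q (a m) x1
      (convex_predI cD cC) hq (ha m) _ _ ax1.
  - by move=> y [Dy Cy] am; apply: h => //; apply: (hS (fun i => a i y <= 0)).
  - by [].
  have [||||l l1 hl] := IH (S :\ m) D (fun y => q y + l0 * a m y) hk' cD.
  - by apply: affine_funD => //; apply: affine_funZ.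
  - by [].
  - by move=> i /setD1P[_ /ax].
  - by move=> y Dy Cy; apply: hl0.
  exists (fun i => if i == m then l0 else l i) => [i|y Dy]; first by case: ifP.
  rewrite (bigD1 m)//= eqxx addrA.
  rewrite [X in _ + X](_ : _ = \sum_(i in S :\ m) l i * a i y).
    exact: hl.
  by apply: eq_big => [i|i /andP[_ /negbTE->]//]; rewrite !inE andbC.
have {}hn y : D y -> C y -> 0 <= a m y.
  by move=> Dy Cy; rewrite leNgt; apply/negP => am; apply: hn; exists y.
have Cx : C x by move=> i /setD1P[_ /ax].
have [|u u0 hu] := IH (S :\ m) D (a m) hk' cD (ha m) xD _ hn; first exact: Cx.
have am0 : a m x = 0 by apply/eqP; rewrite eq_le ax//= hn//; case: xD.
have sx i : i \in S :\ m -> u i * a i x <= 0.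
  by move=> iS; apply: mulr_ge0_le0 => //; apply: Cx.
have hu0 : forall y, D y -> a m y + \sum_(i in S :\ m) u i * a i y = 0.
  apply: (affine_icore_eq0 xD) => //.
    by apply: affine_funD => //; apply: affine_fun_sum.
  by rewrite am0 add0r; apply: sumr_le0.
have ux i : i \in S :\ m -> u i * a i x = 0.
  move=> iS; have := hu0 _ xD.1; rewrite am0 add0r => /eqP.
  rewrite -oppr_eq0 -sumrN psumr_eq0; last by move=> j jS; rewrite oppr_ge0 sx.
  by move=> /allP /(_ i); rewrite mem_index_enum iS oppr_eq0 => /(_ isT) /eqP.
pose E := [set i in S | (i == m) || (u i != 0)].
have sES : E \subset S by apply/fintype.subsetP => i; rewrite inE => /andP[].
have aE i : i \in E -> a i x = 0.
  rewrite inE => /andP[iS]; have [->//|im /= ui] := eqVneq i m.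
  have /ux/eqP : i \in S :\ m by rewrite !inE im.
  by rewrite mulf_eq0 (negbTE ui) => /eqP.
have mE : m \in E by rewrite inE mS eqxx.
pose D' y := D y /\ (forall i, i \in E -> a i y = 0).
have [||||||l l1 hl] := IH (S :\: E) D' q.
- apply: leq_ltn_trans hk'; apply: subset_leq_card.
  by apply/fintype.subsetP => i /setDP[iS iE]; rewrite !inE iS andbT; apply: contraNneq iE => ->.
- apply: convex_predI => // t y z y0 z0 _ _ i iE.
  by rewrite ha y0// z0// !mulr0 addr0.
- exact: hq.
- apply: icore_slice => // e y y0 i iE.
  by rewrite ha y0// aE// !mulr0 addr0.
- by move=> i /setDP[/ax].
- move=> y [Dy Ey] h'; apply: h => // i iS.
  by have [/Ey->//|iE] := boolP (i \in E); apply: h'; rewrite inE iE.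
have [||||v hv] := @eq_multipliers I a E D (fun y => q y + \sum_(i in S :\: E) l i * a i y) x ha cD.
- by apply: affine_funD => //; apply: affine_fun_sum.
- by [].
- exact: aE.
- by move=> y Dy Ey; apply: hl; split.
(* Outside [E] the relation [hu0] has zero coefficients, so it reads as a relation on [E] with
   strictly positive weights [w]. *)
pose w i := if i == m then 1 else u i.
have w0 i : i \in E -> 0 < w i.
  rewrite inE /w => /andP[_]; case: eqP => //= _ ui; by rewrite lt_neqAle eq_sym ui u0.
(* [N] is at least every ratio of [|v i|] to [w i], so shifting by [N * w i] makes all multipliers
   nonnegative, while the relation leaves the Lagrangian unchanged. *)
pose N := \sum_(i in E) `|v i| / w i.
have hN i : i \in E -> 0 <= v i + N * w i.
  move=> iE; have : `|v i| / w i <= N.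
    rewrite /N (bigD1 i)//= lerDl sumr_ge0// => j /andP[jE _].
    by rewrite divr_ge0// ltW// w0.
  rewrite ler_pdivrMr ?w0//; have := ler_norm (- v i); rewrite normrN; lra.
exists (fun i => if i \in E then v i + N * w i else l i) => [i|y Dy].
  by case: ifP => // /hN.
have e0 : \sum_(i in E) w i * a i y = 0.
  rewrite -[RHS](hu0 y Dy) (bigD1 m)//= {1}/w eqxx mul1r; congr (_ + _).
  rewrite [RHS]big_mkcond [LHS]big_mkcond /=; apply: eq_bigr => i _.
  rewrite !inE /w; case: (eqVneq i m) => [->|im] /=; first by rewrite andbF.
  rewrite andbT; case: (i \in S) => //=.
  by case: (eqVneq (u i) 0) => [->|//]; rewrite mul0r.
rewrite (bigID (mem E)) /=.
rewrite [X in _ + (X + _)](_ : _ = \sum_(i in E) v i * a i y).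
  rewrite [X in _ + (_ + X)](_ : _ = \sum_(i in S :\: E) l i * a i y).
    by rewrite [X in _ + X]addrC addrA; apply: hv.
  by apply: eq_big => [i|i /andP[_ /negbTE->]//]; rewrite !inE andbC.
transitivity (\sum_(i in E) (v i * a i y + N * (w i * a i y))).
  apply: eq_big => [i|i /andP[_ ->]]; last by ring.
  by apply: andb_idl => /(fintype.subsetP sES).
by rewrite big_split /= -mulr_sumr e0 mulr0 addr0.
Qed.

(** Inequalities are treated first, on the slice of [D] where the equations hold; their Lagrangian
    then serves as objective for the equations. *)
Lemma convex_multipliers (I J : finType) (a : I -> W -> R) (e : J -> W -> R) D q x :
  (forall i, affine_fun (a i)) -> (forall j, affine_fun (e j)) ->
  convex_pred D -> affine_fun q -> icore D x ->
  (forall i, a i x <= 0) -> (forall j, e j x = 0) ->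
  (forall y, D y -> (forall i, a i y <= 0) -> (forall j, e j y = 0) -> 0 <= q y) ->
  exists (l : I -> R) (v : J -> R), (forall i, 0 <= l i) /\
    forall y, D y -> 0 <= q y + \sum_i l i * a i y + \sum_j v j * e j y.
Proof.
move=> ha he cD hq xD ax ex h.
have [|||||l l0 hl] := @ineq_multipliers I a [set: I] (fun y => D y /\ forall j, e j y = 0) q x ha.
- apply: convex_predI => // t y z y0 z0 _ _ i.
  by rewrite he y0// z0// !mulr0 addr0.
- exact: hq.
- by apply: icore_slice => // t y y0 i; rewrite he y0// ex// !mulr0 addr0.
- by [].
- by move=> y [Dy Ey] Iy; apply: h => // i; apply: Iy.
have [||||v hv] := @eq_multipliers J e [set: J] D (fun y => q y + \sum_(i in [set: I]) l i * a i y) x he cD.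
- by apply: affine_funD => //; apply: affine_fun_sum.
- by [].
- by [].
- by move=> y Dy Ey; apply: hl; split=> // j; apply: Ey.
have sT (K : finType) (F : K -> R) : \sum_(i in [set: K]%SET) F i = \sum_i F i.
  by apply: eq_bigl => i; rewrite inE.
by exists l, v; split=> // y Dy; have := hv y Dy; rewrite !sT.
Qed.

(** The prolongation past [x] can be shortened by convexity, so two sets can share one ratio [e], as
    a product requires. *)
Lemma icore_le D x y : convex_pred D -> icore D x -> D y ->
  exists2 e0 : R, 1 < e0 & forall e, 1 < e -> e <= e0 -> D (e *: x + (1 - e) *: y).
Proof.
move=> cD [Dx h] /h[e0 e01 De0]; exists e0 => // e e1 ee0.
have d0 : 0 < e0 - 1 by lra.
have d1 : e0 - 1 != 0 by rewrite gt_eqF.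
pose s := (e - 1) / (e0 - 1).
rewrite (_ : e *: x + _ = s *: (e0 *: x + (1 - e0) *: y) + (1 - s) *: x).
  apply: cD => //; first by apply: divr_ge0; lra.
  by rewrite ler_pdivrMr//; lra.
rewrite scalerDr !scalerA addrAC -scalerDl.
by congr (_ *: _ + _ *: _); rewrite /s; field.
Qed.

End Multipliers.

(** * Inner products, small perturbations and uniform radii *)

Section Vectors.
Set Implicit Arguments. Unset Strict Implicit.
Variable R : realType.

Lemma dotvC n (x y : 'cV[R]_n) : dotv x y = dotv y x.
Proof. by apply: eq_bigr => i _; rewrite mulrC. Qed.

Lemma dotvDr n (u x y : 'cV[R]_n) : dotv u (x + y) = dotv u x + dotv u y.
Proof. by rewrite -big_split; apply: eq_bigr => i _; rewrite !mxE mulrDr. Qed.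

Lemma dotvZr n (c : R) (u x : 'cV[R]_n) : dotv u (c *: x) = c * dotv u x.
Proof. by rewrite mulr_sumr; apply: eq_bigr => i _; rewrite !mxE mulrCA. Qed.

Lemma dotvNr n (u x : 'cV[R]_n) : dotv u (- x) = - dotv u x.
Proof. by rewrite -scaleN1r dotvZr mulN1r. Qed.

Lemma dotvBr n (u x y : 'cV[R]_n) : dotv u (x - y) = dotv u x - dotv u y.
Proof. by rewrite dotvDr dotvNr. Qed.

Lemma dotvDl n (u x y : 'cV[R]_n) : dotv (x + y) u = dotv x u + dotv y u.
Proof. by rewrite !(dotvC _ u) dotvDr. Qed.

Lemma dotvBl n (u x y : 'cV[R]_n) : dotv (x - y) u = dotv x u - dotv y u.
Proof. by rewrite !(dotvC _ u) dotvBr. Qed.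

Lemma dotvNl n (u x : 'cV[R]_n) : dotv (- x) u = - dotv x u.
Proof. by rewrite !(dotvC _ u) dotvNr. Qed.

Lemma dotvZl n (c : R) (u x : 'cV[R]_n) : dotv (c *: x) u = c * dotv x u.
Proof. by rewrite !(dotvC _ u) dotvZr. Qed.

Lemma dotv_adj n m (A : 'M[R]_(m, n)) (y : 'cV[R]_m) (x : 'cV[R]_n) :
  dotv (A^T *m y) x = dotv y (A *m x).
Proof.
rewrite /dotv; under eq_bigr do rewrite mxE mulr_suml.
rewrite exchange_big; apply: eq_bigr => j _; rewrite mxE mulr_sumr.
by apply: eq_bigr => i _; rewrite mxE mulrAC mulrA mulrC mulrA.
Qed.

Lemma dotv_delta n (u : 'cV[R]_n) i : dotv u (delta_mx i 0) = u i 0.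
Proof.
rewrite /dotv (bigD1 i)//= mxE !eqxx mulr1 big1 ?addr0// => j /negbTE ji.
by rewrite mxE ji mulr0.
Qed.

Lemma dotv_eq0 n (u : 'cV[R]_n) : (forall x, dotv u x = 0) -> u = 0.
Proof. by move=> h; apply/colP => i; rewrite -dotv_delta h mxE. Qed.

Lemma small_multiple n (h : 'cV[R]_n) (d : R) : 0 < d ->
  exists2 e : R, 0 < e & forall c, 0 <= c -> c <= e -> forall i, `|c * h i 0| < d.
Proof.
move=> d0; have s0 : 0 <= \sum_i `|h i 0| by apply: sumr_ge0.
exists (d / (1 + \sum_i `|h i 0|)); first by apply: divr_gt0 => //; lra.
move=> c c0; rewrite ler_pdivlMr; last by lra.
move=> hc i; rewrite normrM (ger0_norm c0).
have : `|h i 0| <= \sum_i `|h i 0| by rewrite (bigD1 i)//= lerDl sumr_ge0.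
have := normr_ge0 (h i 0).
move: {h s0} (\sum_i _) `|_| hc => s t *; nra.
Qed.

Lemma near_in_small n (x h : 'cV[R]_n) (d : R) : 0 < d ->
  exists2 e : R, 0 < e & forall c, 0 <= c -> c <= e -> near_in d x (x + c *: h).
Proof.
move=> /(@small_multiple n h)[e e0 he]; exists e => // c c0 ce i.
by rewrite !mxE addrAC subrr add0r; apply: he.
Qed.

Lemma near_in_mulmx n r (B : 'M[R]_(r, n)) (d : R) : 0 < d ->
  exists2 e : R, 0 < e & forall x x', near_in e x x' -> near_in d (B *m x) (B *m x').
Proof.
move=> d0; have s0 : 0 <= \sum_i \sum_j `|B i j| by apply: sumr_ge0 => i _; apply: sumr_ge0.
pose e := d / (1 + \sum_i \sum_j `|B i j|).
have e0 : 0 < e by apply: divr_gt0 => //; lra.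
exists e => // x x' xx' i.
have -> : (B *m x') i 0 - (B *m x) i 0 = \sum_j B i j * (x' j 0 - x j 0).
  by rewrite !mxE -sumrB; apply: eq_bigr => j _; rewrite mulrBr.
apply: le_lt_trans (ler_norm_sum _ _ _) _.
apply: le_lt_trans (_ : \sum_j `|B i j| * e < d).
  by apply: ler_sum => j _; rewrite normrM ler_wpM2l// ltW.
rewrite -mulr_suml.
have h : \sum_j `|B i j| <= \sum_i \sum_j `|B i j|.
  by rewrite [X in _ <= X](bigD1 i)//= lerDl; apply: sumr_ge0 => k _; apply: sumr_ge0.
have : e * (1 + \sum_i \sum_j `|B i j|) = d by rewrite divfK// gt_eqF//; lra.
by move: h; move: (\sum_j _) (\sum_i _) => S T h <-; nra.
Qed.

Lemma finite_lower_bound r (h : 'I_r -> R) : (forall i, 0 < h i) ->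
  exists2 d : R, 0 < d & forall i, d <= h i.
Proof.
move=> h0; have s0 : 0 <= \sum_i (h i)^-1 by apply: sumr_ge0 => i _; rewrite invr_ge0 ltW.
(* This replaces a minimum and remains positive when [r = 0]. *)
exists (1 + \sum_i (h i)^-1)^-1 => [|i]; first by rewrite invr_gt0; lra.
rewrite -[h i]invrK lef_pV2 ?posrE ?invr_gt0//; last by lra.
rewrite (bigD1 i)//= addrCA lerDl addr_ge0// sumr_ge0// => j _.
by rewrite invr_ge0 ltW.
Qed.

Lemma bounded_affine_slope0 (c k : R) : (forall t, 0 <= c + t * k) -> k = 0.
Proof.
move=> h; apply/eqP/negPn/negP => k0.
(* At this [t] the affine function equals -1. *)
by have := h (- (c + 1) / k); rewrite divfK//; lra.
Qed.

End Vectors.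

(** * Products of convex sets and their cores *)

Section Icore.
Set Implicit Arguments. Unset Strict Implicit.
Variables (R : realType) (W W' : lmodType R).

Lemma icore_pair (D : W -> Prop) (D' : W' -> Prop) x x' :
  convex_pred D -> convex_pred D' -> icore D x -> icore D' x' ->
  @icore R (W * W')%type (fun w => D w.1 /\ D' w.2) (x, x').
Proof.
move=> cD cD' hx hx'; split=> [|[y y'] /= [Dy Dy']].
  by split; [case: hx|case: hx'].
have [e e1 he] := icore_le cD hx Dy.
have [e' e'1 he'] := icore_le cD' hx' Dy'.
exists (Num.min e e'); first by rewrite lt_min e1.
by split; [apply: he|apply: he']; rewrite ?lt_min ?e1// ge_min lexx ?orbT.
Qed.

Lemma convex_pred_pair (D : W -> Prop) (D' : W' -> Prop) :
  convex_pred D -> convex_pred D' ->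
  @convex_pred R (W * W')%type (fun w => D w.1 /\ D' w.2).
Proof.
by move=> cD cD' t x y [Dx Dx'] [Dy Dy'] t0 t1; split; [apply: cD|apply: cD'].
Qed.

End Icore.

(** * Epigraphs, Slater points and multipliers for a sum of functions *)

Section Epigraph.
Set Implicit Arguments. Unset Strict Implicit.
Variable R : realType.

Lemma proper_fin n (f : 'cV[R]_n -> \bar R) x :
  proper_fun f -> (f x < +oo)%E -> exists c : R, f x = c%:E.
Proof. by move=> [pf _]; case: (f x) (pf x) => // c _ _; exists c. Qed.

(** The height lies in [R^o] so that the product is a module, as the multiplier theorems require. *)
Definition epi n (f : 'cV[R]_n -> \bar R) (w : 'cV[R]_n * R^o) : Prop :=
  (f w.1 <= (w.2 : R)%:E)%E.

Lemma convex_epi n (f : 'cV[R]_n -> \bar R) : convex_fun f -> convex_pred (epi f).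
Proof. by move=> cf t [x a] [y c] /= fx fy t0 t1; apply: cf. Qed.

(** A short prolongation of the segment from [y] past [x] stays in the affine hull, hence in the
    domain. The height [c + 1] leaves one unit of slack above the graph, which absorbs the growth of
    [f] along a short enough prolongation. *)
Lemma relint_icore n (f : 'cV[R]_n -> \bar R) x (c : R) :
  proper_fun f -> convex_fun f -> relint (edom f) x -> f x = c%:E ->
  icore (epi f) (x, (c + 1 : R^o)).
Proof.
move=> pf cf [dx [d d0 hd]] fx; split=> [|[y s] /= fy].
  by rewrite /epi /= fx lee_fin; lra.
have [k k0 hk] := @near_in_small R n x (x - y) d d0.
have {}hk := hk k (ltW k0) (lexx k).
have [M fM] : exists M : R, f (x + k *: (x - y)) = M%:E.
  apply: proper_fin => //; apply: hd => //.
  exists 2%N, (fun j => if j == 0 then x else y), (fun j => if j == 0 then 1 + k else - k).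
  split.
  - move=> j; case: ifP => // _; rewrite /edom /=; exact: le_lt_trans fy (ltry _).
  - by rewrite !big_ord_recl big_ord0 /=; ring.
  - rewrite !big_ord_recl big_ord0 /=.
    by apply/colP => i; rewrite !mxE; ring.
(* [K] is the growth of the chord from [c] to [M] relative to the prolonged segment; scaling by [t]
   brings it below the unit of slack. *)
pose K := M - c - k * (c + 1 - s).
pose t := (1 + `|K|)^-1.
have K0 := normr_ge0 K.
have t0 : 0 < t by rewrite invr_gt0; lra.
have t1 : t <= 1 by rewrite invf_le1; lra.
have tK : t * K <= 1.
  apply: le_trans (_ : t * `|K| <= 1); first by rewrite ler_pM2l// ler_norm.
  by rewrite mulrC ler_pdivrMr; lra.
exists (1 + t * k); first by rewrite ltrDl mulr_gt0.
rewrite /epi /= (_ : _ + _ = t *: (x + k *: (x - y)) + (1 - t) *: x); last first.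
  by apply/colP => i; rewrite !mxE; ring.
apply: le_trans (cf _ _ M c t _ _ (ltW t0) t1) _; rewrite ?fM ?fx//.
rewrite lee_fin; move: tK; rewrite /K /GRing.scale /=; lra.
Qed.

(* The two forms of Slater's condition unified: the non-polyhedral part of the
   description of the epigraph has the given point in its core. *)
Lemma slater_epi n (f : 'cV[R]_n -> \bar R) x :
  proper_fun f -> convex_fun f -> slater_pt f x ->
  exists (D : 'cV[R]_n * R^o -> Prop) (k : nat) (a : 'I_k -> 'cV[R]_n * R^o -> R) (t : R^o),
    [/\ convex_pred D, forall j, affine_fun (a j), icore D (x, t),
        forall j, a j (x, t) <= 0 &
        forall w, epi f w <-> D w /\ forall j, a j w <= 0].
Proof.
move=> pf cf [rx|[[_ [k [a [c [d h]]]]] dx]].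
  have [v fv] := proper_fin pf rx.1.
  exists (epi f), 0%N, (fun _ _ => 0), (v + 1); split=> //.
  - exact: convex_epi.
  - by move=> j; apply: affine_fun_cst.
  - exact: relint_icore.
  - by move=> w; split=> [|[]].
have [v fv] := proper_fin pf dx.
exists (fun=> True), k, (fun j w => dotv (a j) w.1 + c j * w.2 - d j), v; split=> //.
- move=> j t y z /=; rewrite dotvDr !dotvZr /GRing.scale /=; ring.
- by split=> // y _; exists 2 => //; lra.
- move=> j; rewrite subr_le0 /=; apply/(h x v).1; by rewrite fv.
- move=> [y t]; rewrite /epi /=; split=> [/h hj|[_ hj]]; first by split=> // j; rewrite subr_le0.
  by apply/h => j; rewrite -subr_le0.
Qed.

(** The two epigraphs receive their own variables, tied to [w] by the equations [L w = xi] and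
    [M w = eta]. The multipliers [x] and [y] of these equations become the subgradients; the lemma
    serves both the primal and the dual problem. *)
Lemma fenchel_multipliers (W : lmodType R) (p k : nat) (I J : finType)
  (phi : 'cV[R]_p -> \bar R) (gam : 'cV[R]_k -> \bar R)
  (L : W -> 'cV[R]_p) (M : W -> 'cV[R]_k) (c : W -> R)
  (a : I -> W -> R) (e : J -> W -> R) (v : R) (w0 : W) :
  proper_fun phi -> convex_fun phi -> proper_fun gam -> convex_fun gam ->
  (forall i, affine_fun (fun w => L w i 0)) -> (forall i, affine_fun (fun w => M w i 0)) ->
  affine_fun c -> (forall i, affine_fun (a i)) -> (forall j, affine_fun (e j)) ->
  slater_pt phi (L w0) -> slater_pt gam (M w0) ->
  (forall i, a i w0 <= 0) -> (forall j, e j w0 = 0) ->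
  (forall w (t s : R), (phi (L w) <= t%:E)%E -> (gam (M w) <= s%:E)%E ->
     (forall i, a i w <= 0) -> (forall j, e j w = 0) -> v <= t + s + c w) ->
  exists (x : 'cV[R]_p) (y : 'cV[R]_k) (l : I -> R) (u : J -> R),
    (forall i, 0 <= l i) /\
    forall w xi eta (t s : R), (phi xi <= t%:E)%E -> (gam eta <= s%:E)%E ->
      v <= t + s + c w + dotv x (L w - xi) + dotv y (M w - eta) +
           \sum_i l i * a i w + \sum_j u j * e j w.
Proof.
move=> pphi cphi pgam cgam hL hM hc ha he s1 s2 a0 e0 hv.
have [D1 [k1 [a1 [t1 [cD1 ha1 i1 a10 ep1]]]]] := slater_epi pphi cphi s1.
have [D2 [k2 [a2 [t2 [cD2 ha2 i2 a20 ep2]]]]] := slater_epi pgam cgam s2.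
pose V := ((('cV[R]_p * R^o) * ('cV[R]_k * R^o)) * W)%type.
pose D12 (w : ('cV[R]_p * R^o) * ('cV[R]_k * R^o)) := D1 w.1 /\ D2 w.2.
have cD12 : convex_pred D12 by apply: convex_pred_pair.
pose D (w : V) := D12 w.1 /\ True.
pose aa (i : 'I_k1 + 'I_k2 + I) (w : V) : R := match i with
  | inl (inl j) => a1 j w.1.1 | inl (inr j) => a2 j w.1.2 | inr j => a j w.2 end.
pose ee (i : 'I_p + 'I_k + J) (w : V) : R := match i with
  | inl (inl j) => (L w.2 - w.1.1.1) j 0 | inl (inr j) => (M w.2 - w.1.2.1) j 0
  | inr j => e j w.2 end.
pose q (w : V) : R := (w.1.1.2 : R) + w.1.2.2 + c w.2 - v.
have [||||||||l [u [l0 hu]]] := @convex_multipliers R V _ _ aa ee D q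
    ((L w0, t1), (M w0, t2), w0).
- by move=> [[j|j]|j] t x y /=; rewrite (ha1, ha2, ha).
- move=> [[j|j]|j] t x y /=; rewrite ?he// !mxE.
    by rewrite (hL j); ring.
  by rewrite (hM j); ring.
- exact: (@convex_pred_pair R _ _ D12 (fun=> True)).
- by move=> t x y; rewrite /q /= hc /GRing.scale /=; ring.
- apply: (@icore_pair R _ _ D12 (fun=> True)) => //; first exact: icore_pair.
  by split=> // y _; exists 2 => //; lra.
- by move=> [[j|j]|j] /=.
- by move=> [[j|j]|j] /=; rewrite ?e0// !mxE subrr.
- move=> [[[x t] [y s]] w] /= [[D1x D2y] _] aw ew.
  have ex : L w = x.
    by apply/colP => i; have := ew (inl (inl i)); rewrite /= !mxE => /subr0_eq.
  have ey : M w = y.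
    by apply/colP => i; have := ew (inl (inr i)); rewrite /= !mxE => /subr0_eq.
  rewrite /q /= subr_ge0; apply: hv.
  + rewrite ex; apply: (ep1 (x, t)).2; split=> // j; exact: (aw (inl (inl j))).
  + rewrite ey; apply: (ep2 (y, s)).2; split=> // j; exact: (aw (inl (inr j))).
  + by move=> i; apply: (aw (inr i)).
  + by move=> j; apply: (ew (inr j)).
exists (\col_i u (inl (inl i))), (\col_i u (inl (inr i))),
  (fun i => l (inr i)), (fun j => u (inr j)); split=> [i|w xi eta t s fx gy]; first exact: l0.
have [Dx ax] := (ep1 (xi, t : R^o)).1 fx; have [Dy ay] := (ep2 (eta, s : R^o)).1 gy.
have := hu ((xi, t : R^o), (eta, s : R^o), w) (conj (conj Dx Dy) Logic.I).
rewrite !big_sumType /= /q /=.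
have n1 : \sum_i l (inl (inl i)) * a1 i (xi, t : R^o) <= 0.
  by apply: sumr_le0 => i _; apply: mulr_ge0_le0.
have n2 : \sum_i l (inl (inr i)) * a2 i (eta, s : R^o) <= 0.
  by apply: sumr_le0 => i _; apply: mulr_ge0_le0.
have d1 : dotv (\col_i u (inl (inl i))) (L w - xi) = \sum_i u (inl (inl i)) * (L w - xi) i 0.
  by apply: eq_bigr => i _; rewrite mxE.
have d2 : dotv (\col_i u (inl (inr i))) (M w - eta) = \sum_i u (inl (inr i)) * (M w - eta) i 0.
  by apply: eq_bigr => i _; rewrite mxE.
rewrite d1 d2; lra.
Qed.

End Epigraph.

(** * Conjugates, separation, Fenchel-Moreau and weak duality *)

Section Conjugate.
Set Implicit Arguments. Unset Strict Implicit.
Variable R : realType.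

(** Fenchel-Young through real upper bounds, which keeps infinite values out of the arithmetic. *)
Lemma conj_fun_ge n (f : 'cV[R]_n -> \bar R) q x (t s : R) :
  (f x <= t%:E)%E -> (conj_fun f q <= s%:E)%E -> dotv q x <= t + s.
Proof.
move=> fx fq; have : ((dotv q x)%:E - f x <= s%:E)%E.
  by apply: le_trans fq; apply: ereal_sup_ubound; exists x.
move: fx; case: (f x) => [v||] //=; rewrite ?leye_eq//=.
by rewrite -EFinB !lee_fin; lra.
Qed.

Lemma conj_fun_le n (f : 'cV[R]_n -> \bar R) q (s : R) : proper_fun f ->
  (forall x t, (f x <= t%:E)%E -> dotv q x <= t + s) -> (conj_fun f q <= s%:E)%E.
Proof.
move=> [pf _] h; apply: ge_ereal_sup => _ [x _ <-].
move: (pf x) (h x); case: (f x) => [v||] //= _ hv; last by rewrite leNye.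
by rewrite -EFinB lee_fin; have := hv v (lexx _); lra.
Qed.

Lemma conj_fun_neqNy n (f : 'cV[R]_n -> \bar R) q : proper_fun f -> conj_fun f q != -oo%E.
Proof.
move=> pf; have [x fx] := pf.2; have [v fv] := proper_fin pf fx.
apply/negP => /eqP h.
have := @conj_fun_ge n f q x v (dotv q x - v - 1); rewrite fv h lexx leNye.
by move=> /(_ isT isT); lra.
Qed.

Lemma convex_conj_fun n (f : 'cV[R]_n -> \bar R) : proper_fun f -> convex_fun (conj_fun f).
Proof.
move=> pf x y a c t hx hy t0 t1; apply: conj_fun_le => // z s fz.
rewrite dotvDl !dotvZl.
have := conj_fun_ge fz hx; have := conj_fun_ge fz hy; nra.
Qed.

(** If [(x, t) - (p, a)] is [tau] times [(x0, t0) - (p, a)] with [tau < 0], then [(p, a)] is a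
    convex combination of two points of [D]. So these equations force [tau >= 0]; their multipliers
    form the separating functional, and freedom of [tau] normalizes it to 1 at [(x0, t0)]. *)
Lemma separate_point n (D : 'cV[R]_n * R^o -> Prop) x0 t0 p a :
  convex_pred D -> icore D (x0, t0) -> ~ D (p, a) ->
  exists (u : 'cV[R]_n) (k : R), dotv u (x0 - p) + k * (t0 - a) = 1 /\
    forall x t, D (x, t) -> 0 <= dotv u (x - p) + k * (t - a).
Proof.
move=> cD iD nD.
pose V := (('cV[R]_n * R^o) * R^o)%type.
pose D' (w : V) := D w.1 /\ True.
pose ee (i : 'I_n + 'I_1) (w : V) : R := match i with
  | inl j => w.1.1 j 0 - p j 0 - (w.2 : R) * (x0 j 0 - p j 0)
  | inr j => (w.1.2 : R) - a - (w.2 : R) * (t0 - a) end.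
have [||||||||l [v [_ hv]]] := @convex_multipliers R V 'I_0 ('I_n + 'I_1)%type (fun _ _ => 0) ee D'
  (fun w => w.2 : R) ((x0, t0), 1 : R^o).
- by move=> i; apply: affine_fun_cst.
- by move=> [j|j] t x y /=; rewrite ?mxE /GRing.scale /=; ring.
- exact: (@convex_pred_pair R _ _ D (fun=> True)).
- by move=> t x y /=; rewrite /GRing.scale.
- apply: (@icore_pair R _ _ D (fun=> True)) => //.
  by split=> // y _; exists 2 => //; lra.
- by case.
- by move=> [j|j] /=; ring.
- move=> [[x t] tau] /= [Dx _] _ ew; rewrite leNgt; apply/negP => tau0; apply: nD.
  have n0 : 1 - tau != 0 by rewrite gt_eqF//; lra.
  have mix (b y y0 : R) : y - b - tau * (y0 - b) = 0 ->
      b = (1 - tau)^-1 * y + (1 - (1 - tau)^-1) * y0.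
    move=> h; have -> : y = b + tau * (y0 - b) by lra.
    by field.
  have -> : (p, a) = (1 - tau)^-1 *: (x, t) + (1 - (1 - tau)^-1) *: (x0, t0).
    congr pair; last exact: (mix _ _ _ (ew (inr ord0))).
    by apply/colP => i; rewrite !mxE; apply: mix; apply: (ew (inl i)).
  apply: cD => //; first by case: iD.
    by rewrite invr_ge0; lra.
  by rewrite invf_le1; lra.
pose u := \col_i v (inl i); pose k := v (inr ord0).
have {}hv x t (tau : R) : D (x, t) -> 0 <= (dotv u (x - p) + k * (t - a)) +
    tau * (1 - (dotv u (x0 - p) + k * (t0 - a))).
  move=> Dx; have := hv ((x, t), tau : R^o) (conj Dx Logic.I).
  rewrite big_ord0 big_sumType /= big_ord1 /= addr0 -/k.
  rewrite (_ : \sum_i _ = dotv u (x - p) - tau * dotv u (x0 - p)); first by lra.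
  rewrite -dotvZr -dotvBr; apply: eq_bigr => i _; rewrite !mxE; ring.
exists u, k; split.
  by have := @bounded_affine_slope0 R _ _ (fun tau => hv _ _ tau iD.1); lra.
by move=> x t /(hv _ _ 0); rewrite mul0r addr0.
Qed.

(** Weak separation from the thickened epigraph is separation from the epigraph with a margin
    proportional to the l1 norm of [u]. For [k = 0] the normalization forces [u] to be nonzero, so
    the margin is positive. *)
Lemma lsc_separation n (f : 'cV[R]_n -> \bar R) p (a : R) :
  proper_fun f -> lsc_fun f -> convex_fun f -> (a%:E < f p)%E ->
  exists (u : 'cV[R]_n) (k d : R), [/\ 0 <= k, 0 <= d, k = 0 -> 0 < d &
    forall x t, (f x <= t%:E)%E -> d <= dotv u (x - p) + k * (t - a)].
Proof.
move=> pf lf cf fp; have [d d0 hd] := lf _ _ fp.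
have [x0 fx0] := pf.2; have [v0 fv0] := proper_fin pf fx0.
pose D (w : 'cV[R]_n * R^o) := exists2 h : 'cV[R]_n,
  (forall i, `|h i 0| < d) & (f (w.1 + h)%R <= (w.2 : R)%:E)%E.
have [|||u [k [hu hD]]] := @separate_point n D x0 (v0 + 1) p a.
- move=> t [x a1] [y a2] [h hh fh] [g hg fg] t0 t1.
  exists (t *: h + (1 - t) *: g).
    move=> i; rewrite !mxE; apply: le_lt_trans (ler_normD _ _) _.
    rewrite !normrM (ger0_norm t0) (ger0_norm (x := 1 - t)); last by lra.
    apply: le_lt_trans (_ : Num.max `|h i 0| `|g i 0| < d); last by rewrite gt_max hh hg.
    have : `|h i 0| <= Num.max `|h i 0| `|g i 0| by rewrite le_max lexx.
    have : `|g i 0| <= Num.max `|h i 0| `|g i 0| by rewrite le_max lexx orbT.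
    by nra.
  rewrite /= (_ : _ + _ + _ = t *: (x + h) + (1 - t) *: (y + g)); first exact: cf.
  by apply/colP => i; rewrite !mxE; ring.
- split; first by exists 0 => [i|]; rewrite ?mxE ?normr0 ?addr0//= fv0 lee_fin; lra.
  move=> [x t] [h hh fh].
  have [e e0 he] := @small_multiple R n (x - x0) d d0.
  pose K : R := v0 + 1 - t.
  have K0 := normr_ge0 K.
  (* The first bound keeps the shift back to [x0] inside the box; the second lets the unit of slack
     above [v0] absorb the change of height. *)
  pose c := Num.min e (1 + `|K|)^-1.
  have c0 : 0 < c by rewrite lt_min e0 invr_gt0; lra.
  have cK : - 1 <= c * K.
    have h1 : c * `|K| <= 1.
      have : c <= (1 + `|K|)^-1 by rewrite ge_min lexx orbT.
      rewrite -[X in _ <= X]div1r ler_pdivlMr; nra.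
    have : - `|K| <= K by rewrite lerNl -normrN ler_norm.
    nra.
  exists (1 + c); first by lra.
  exists (c *: (x - x0)).
    by move=> i; rewrite mxE; apply: he; rewrite ?ge_min ?lexx// ltW.
  rewrite /= (_ : _ + _ + _ = x0); last by apply/colP => i; rewrite !mxE; ring.
  rewrite fv0 lee_fin /GRing.scale /=; move: cK; rewrite /K; lra.
- by move=> [h hh]; rewrite /= leNgt hd// => i; rewrite !mxE addrAC subrr add0r.
(* Epigraphs are unbounded upwards: for negative [k] a high enough point over [x0] gives the
   functional the value -1. *)
have k0 : 0 <= k.
  rewrite leNgt; apply/negP => kn.
  pose A := dotv u (x0 - p) + k * (v0 - a).
  have A0 : 0 <= A.
    apply: hD; exists 0 => [i|]; rewrite ?mxE ?normr0 ?addr0//= fv0 lee_fin; lra.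
  have : D (x0, v0 + (A + 1) / - k).
    exists 0 => [i|]; rewrite ?mxE ?normr0 ?addr0//= fv0 lee_fin lerDl.
    by apply: divr_ge0; lra.
  move=> /hD; rewrite -/A.
  have -> : k * (v0 + (A + 1) / - k - a) = k * (v0 - a) - (A + 1).
    by field; rewrite lt_eqF.
  by rewrite /A; lra.
exists u, k, (d / 2 * \sum_i `|u i 0|); split=> //.
- by apply: mulr_ge0; [lra|apply: sumr_ge0].
- move=> k00; apply: mulr_gt0; first lra.
  rewrite lt_neqAle sumr_ge0// andbT eq_sym; apply/negP.
  rewrite psumr_eq0// => /allP h.
  have : dotv u (x0 - p) = 0.
    rewrite /dotv big1// => i _; have := h i; rewrite mem_index_enum normr_eq0 => /(_ isT) /eqP->.
    by rewrite mul0r.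
  by move: hu; rewrite k00; lra.
move=> x t fx.
(* The sign vector of [u] maximizes [dotv u h] on a closed box; halving [d] keeps it in the open
   one. *)
pose h := \col_i (d / 2 * Num.sg (u i 0)).
have : D (x - h, t).
  exists h; last by rewrite /= subrK.
  move=> i; rewrite mxE normrM ger0_norm; last by lra.
  by rewrite normr_sg; case: (_ != 0); rewrite ?mulr1 ?mulr0//; lra.
move=> /hD; rewrite addrAC (dotvBr u (x - p)).
have -> : dotv u h = d / 2 * \sum_i `|u i 0|.
  by rewrite mulr_sumr; apply: eq_bigr => i _; rewrite mxE mulrCA (normrEsg (u i 0)); ring.
by lra.
Qed.

(** A non-vertical hyperplane is the graph of an affine minorant of [f] with slope [- k^-1 *: u] and
    value [a] at [p]. *)
Lemma conj_fun_separation n (f : 'cV[R]_n -> \bar R) p u (a k : R) :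
  proper_fun f -> 0 < k ->
  (forall x t, (f x <= t%:E)%E -> 0 <= dotv u (x - p) + k * (t - a)) ->
  (conj_fun f (- k^-1 *: u) <= (- k^-1 * dotv u p - a)%:E)%E.
Proof.
move=> pf k0 hu; have kn0 : k != 0 by rewrite gt_eqF.
apply: conj_fun_le => // x t /hu; rewrite dotvZl dotvBr => h.
rewrite -(ler_pM2l k0).
have -> : k * (- k^-1 * dotv u x) = - dotv u x by field.
have -> : k * (t + (- k^-1 * dotv u p - a)) = k * (t - a) - dotv u p by field.
lra.
Qed.

Lemma affine_minorant n (f : 'cV[R]_n -> \bar R) :
  proper_fun f -> lsc_fun f -> convex_fun f ->
  exists (q : 'cV[R]_n) (s : R), (conj_fun f q <= s%:E)%E.
Proof.
move=> pf lf cf; have [x0 fx0] := pf.2; have [v0 fv0] := proper_fin pf fx0.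
have [|u [k [d [k0 d0 kd hu]]]] := @lsc_separation n f x0 (v0 - 1) pf lf cf.
  by rewrite fv0 lte_fin; lra.
have {kd}k1 : 0 < k.
  (* A vertical hyperplane is excluded: over [x0] itself the functional would be 0, below the
     positive margin. *)
  rewrite lt_neqAle k0 andbT; apply/negP => /eqP /esym kk.
  have := hu x0 v0; rewrite fv0 lexx => /(_ isT).
  by rewrite dotvBr subrr kk mul0r addr0 leNgt kd.
exists (- k^-1 *: u), (- k^-1 * dotv u x0 - (v0 - 1)).
by apply: conj_fun_separation => // x t /hu; apply: le_trans.
Qed.

Lemma biconj_le n (f : 'cV[R]_n -> \bar R) p (c : R) :
  proper_fun f -> lsc_fun f -> convex_fun f ->
  (forall q s, (conj_fun f q <= s%:E)%E -> dotv q p <= c + s) -> (f p <= c%:E)%E.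
Proof.
move=> pf lf cf h; rewrite leNgt; apply/negP => fp.
have [a ca fa] : exists2 a : R, c < a & (a%:E < f p)%E.
  case: (f p) fp => [v||] // cv; last by exists (c + 1); [lra|rewrite ltry].
  by rewrite lte_fin in cv; exists ((c + v) / 2); [|rewrite lte_fin]; lra.
have [u [k [d [k0 d0 kd hu]]]] := lsc_separation pf lf cf fa.
have [kk|kk] := eqVneq k 0.
  have {}kd := kd kk.
  have [q0 [s0 h0]] := affine_minorant pf lf cf.
  pose B := c + s0 - dotv q0 p.
  have B0 : 0 <= B by have := h _ _ h0; rewrite /B; lra.
  (* In the vertical case an affine minorant is tilted by [N] times the hyperplane. [B] is the gap
     between [c] and the minorant at [p], and the gain [N * d] there exceeds it by one. *)
  pose N := (B + 1) / d.
  have N0 : 0 <= N by apply: divr_ge0; lra.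
  have := h (q0 - N *: u) (s0 - N * dotv u p - N * d).
  rewrite dotvBl dotvZl => hN.
  have Nd : N * d = B + 1 by rewrite divfK// gt_eqF.
  suff : dotv q0 p - N * dotv u p <= c + (s0 - N * dotv u p - N * d) by rewrite Nd /B; lra.
  apply: hN; apply: conj_fun_le => // x t fx.
  rewrite dotvBl dotvZl.
  have := hu _ _ fx; rewrite kk mul0r addr0 dotvBr.
  have := conj_fun_ge fx h0; nra.
have k1 : 0 < k by rewrite lt_neqAle eq_sym kk.
have := h (- k^-1 *: u) (- k^-1 * dotv u p - a).
rewrite dotvZl => hk; suff : - k^-1 * dotv u p <= c + (- k^-1 * dotv u p - a) by lra.
by apply: hk; apply: conj_fun_separation => // x t /hu; apply: le_trans.
Qed.

Lemma conj_fun_lb n (f : 'cV[R]_n -> \bar R) q x (v : R) :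
  (f x <= v%:E)%E -> ((dotv q x - v)%:E <= conj_fun f q)%E.
Proof.
move=> fx; apply: le_trans (_ : ((dotv q x)%:E - f x <= _)%E).
  by rewrite EFinB leeB.
by apply: ereal_sup_ubound; exists x.
Qed.

Lemma proper_conj_fun n (f : 'cV[R]_n -> \bar R) q :
  proper_fun f -> slater_pt (conj_fun f) q -> proper_fun (conj_fun f).
Proof.
move=> pf sq; split; first by move=> x; apply: conj_fun_neqNy.
by exists q; case: sq => [[]|[]].
Qed.

(** Two Fenchel-Young inequalities in which the terms in [A] cancel. The residual
    [dotv z (B *m x - b)] is kept, to be compared with [Phi] or [Psi] coordinatewise. *)
Lemma weak_duality n m r (f : 'cV[R]_n -> \bar R) (g : 'cV[R]_m -> \bar R)
  (A : 'M[R]_(m, n)) (B : 'M[R]_(r, n)) (b : 'cV[R]_r) x y z (s t : R) :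
  (f x <= s%:E)%E -> (g (A *m x) <= t%:E)%E ->
  ((- (s + t) - dotv z (B *m x - b))%:E <= Xi f g A B b y z)%E.
Proof.
move=> fx gx; rewrite /Xi.
have := leeD (leeD (conj_fun_lb (- (A^T *m y) - B^T *m z) fx) (conj_fun_lb y gx))
             (lexx (dotv b z)%:E).
apply: le_trans; rewrite -!EFinD lee_fin.
by rewrite dotvBl dotvNl !dotv_adj dotvBr (dotvC b); lra.
Qed.

End Conjugate.

(** * Transfer of local minimizers between the primal and the dual problem *)

Section Duality.
Set Implicit Arguments. Unset Strict Implicit.
Variables (R : realType) (n m r : nat).
Variables (f : 'cV[R]_n -> \bar R) (g : 'cV[R]_m -> \bar R).
Variables (A : 'M[R]_(m, n)) (B : 'M[R]_(r, n)) (b : 'cV[R]_r) (pos : bool).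
Hypotheses (pf : proper_fun f) (cf : convex_fun f).
Hypotheses (pg : proper_fun g) (cg : convex_fun g).

Lemma Psi_fin (mu : 'I_r -> R) (z : 'cV[R]_r) : (pos -> forall i, 0 <= z i 0) ->
  Psi pos mu z = (\sum_(i < r) (if z i 0 != 0 then mu i else 0))%:E.
Proof.
rewrite /Psi; case: pos => //= /(_ isT) h.
by rewrite ifF//; apply/negbTE/negPn/forallP.
Qed.

Lemma Psi_ltey (mu : 'I_r -> R) (z : 'cV[R]_r) : (Psi pos mu z < +oo)%E ->
  pos -> forall i, 0 <= z i 0.
Proof. by rewrite /Psi; case: pos => //=; case: forallP => // h _ _. Qed.

Definition feasible (u v : 'cV[R]_r) := forall i, u i 0 = 0 ->
  if pos then v i 0 <= 0 else v i 0 == 0.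

(* Along the segment towards a feasible point [Phi] does not increase near [xs],
   so a local minimizer of the nonconvex problem minimizes the convex function
   [Theta] over the feasible polyhedron. *)
Lemma primal_min_feasible (lam : 'I_r -> R) xs (fv gv : R) :
  (forall i, 0 < lam i) -> local_min (Fobj f g A B b pos lam) xs ->
  f xs = fv%:E -> g (A *m xs) = gv%:E ->
  forall x (t s : R), (f x <= t%:E)%E -> (g (A *m x) <= s%:E)%E ->
    feasible (B *m xs - b) (B *m x - b) -> fv + gv <= t + s.
Proof.
move=> lam0 [d d0 hd] fxs gxs x t s fx gx ux.
set u := B *m xs - b in ux.
(* A coordinate that moves by less than [|u i 0|] keeps its sign; 1 is a dummy radius for the zero
   coordinates. *)
pose h i := if u i 0 == 0 then 1 else `|u i 0|.
have [|k k0 hk] := @finite_lower_bound R r h.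
  by move=> i; rewrite /h; case: eqVneq => // ui; rewrite normr_gt0.
have [e1 e10 he1] := @near_in_small R n xs (x - xs) d d0.
have [e2 e20 he2] := @small_multiple R r (B *m (x - xs)) k k0.
pose c := Num.min 1 (Num.min e1 e2).
have c0 : 0 < c by rewrite !lt_min ltr01 e10.
have c1 : c <= 1 by rewrite ge_min lexx.
have ce1 : c <= e1 by rewrite !ge_min lexx orbT.
have ce2 : c <= e2 by rewrite !ge_min lexx !orbT.
have := hd _ (he1 c (ltW c0) ce1).
have xc : xs + c *: (x - xs) = c *: x + (1 - c) *: xs.
  by apply/colP => i; rewrite !mxE; ring.
have uE i : (B *m (xs + c *: (x - xs)) - b) i 0 = u i 0 + c * (B *m (x - xs)) i 0.
  by rewrite mulmxDr -scalemxAr /u !mxE; ring.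
have uE' i : (B *m (x - xs)) i 0 = (B *m x - b) i 0 - u i 0.
  by rewrite mulmxBr /u !mxE; ring.
have hPhi : Phi pos lam (B *m (xs + c *: (x - xs)) - b) <= Phi pos lam u.
  apply: ler_sum => i _; rewrite uE.
  have l0 := lam0 i; have := ux i; have := hk i; rewrite /h; have := he2 c (ltW c0) ce2 i.
  rewrite uE'; case: (eqVneq (u i 0) 0) => [->|ui].
    rewrite subr0 add0r ltxx => _ _ /(_ erefl); case: (pos) => [hx|/eqP->].
      by rewrite ifF//; apply/negbTE; rewrite -leNgt; nra.
    by rewrite mulr0 eqxx.
  move=> h1 h2 _; case: (pos); last by rewrite /=; case: ifP => // _; lra.
  case: (ltgtP (u i 0) 0) ui h2 => // ui _ h2; last by case: ifP => // _; lra.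
  rewrite ifF//; apply/negbTE; rewrite -leNgt.
  have := lt_le_trans h1 h2; rewrite (ltr0_norm ui) => h3.
  by have := le_lt_trans (ler_norm _) h3; lra.
have {}fxs : (f xs <= fv%:E)%E /\ f xs = fv%:E by rewrite fxs.
have {}gxs : (g (A *m xs) <= gv%:E)%E /\ g (A *m xs) = gv%:E by rewrite gxs.
have fxc : (f (xs + c *: (x - xs))%R <= (c * t + (1 - c) * fv)%:E)%E.
  by rewrite xc; apply: cf fx fxs.1 (ltW c0) c1.
have gxc : (g (A *m (xs + c *: (x - xs))) <= (c * s + (1 - c) * gv)%:E)%E.
  by rewrite xc mulmxDr -!scalemxAr; apply: cg gx gxs.1 (ltW c0) c1.
(* Local minimality and convexity combine to [c] times the claim, with [c > 0]. *)
rewrite -lee_fin in hPhi => hF; have := le_trans hF (leeD (leeD fxc gxc) hPhi).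
rewrite /Fobj /Theta fxs.2 gxs.2 -!EFinD lee_fin -/u; nra.
Qed.

(** Varying one argument of the Lagrangian bound while the others sit at the minimizer yields in
    turn the subgradients [y] and [p] and the stationarity equation [p = - A^T y - B^T z]. *)
Lemma primal_to_dual (lam mu : 'I_r -> R) xs :
  (forall i, 0 < lam i) -> (forall i, 0 < mu i) ->
  local_min (Fobj f g A B b pos lam) xs ->
  (Fobj f g A B b pos lam xs < +oo)%E ->
  (exists x, [/\ slater_pt f x, slater_pt g (A *m x) &
                 feasible (B *m xs - b) (B *m x - b)]) ->
  exists ys zs, [/\ csubdiff g (A *m xs) ys, subdiffPhi pos (B *m xs - b) zs,
     local_min2 (Gobj f g A B b pos mu) ys zs &
     Theta f g A xs = (- Xi f g A B b ys zs)%E].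
Proof.
move=> lam0 mu0 lmin Fxs [x0 [sf sg x0u]].
have [fv [gv [fxs gxs]]] : exists fv gv : R, f xs = fv%:E /\ g (A *m xs) = gv%:E.
  move: Fxs; rewrite /Fobj /Theta; have := pf.1 xs; have := pg.1 (A *m xs).
  by case: (f xs) => [fv||]//; case: (g _) => [gv||]// _ _ _; exists fv, gv.
have gmin := primal_min_feasible lam0 lmin fxs gxs.
set u := B *m xs - b in gmin x0u *.
pose a (i : 'I_r) w := if pos && (u i 0 == 0) then (B *m w - b) i 0 else 0.
pose e (i : 'I_r) w := if ~~ pos && (u i 0 == 0) then (B *m w - b) i 0 else 0.
have affB i : affine_fun (fun w => (B *m w - b) i 0).
  by move=> t x y; rewrite mulmxDr -!scalemxAr !mxE; ring.
have [||||||||p [y [l [k [l0 H]]]]] := @fenchel_multipliers R 'cV[R]_n n m 'I_r 'I_r f g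
    id (mulmx A) (fun=> 0) a e (fv + gv) x0 pf cf pg cg _ _ _ _ _ sf sg.
- by move=> i t x y; rewrite !mxE.
- by move=> i t x y; rewrite mulmxDr -!scalemxAr !mxE.
- exact: affine_fun_cst.
- by move=> i t x y; rewrite /a; case: (pos && _); [exact: affB|ring].
- by move=> i t x y; rewrite /e; case: (~~ pos && _); [exact: affB|ring].
- by move=> i; rewrite /a; case: ifP => // /andP[p1 /eqP /x0u]; rewrite p1.
- by move=> i; rewrite /e; case: ifP => // /andP[/negbTE p1 /eqP /x0u]; rewrite p1 => /eqP.
- move=> w t s fw gw aw ew; rewrite addr0; apply: gmin fw gw _ => i ui.
  have := aw i; have := ew i; rewrite /a /e ui eqxx !andbT.
  by case: (pos) => //= ->.
pose z := \col_i (if u i 0 == 0 then if pos then l i else k i else 0).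
have {}H w xi eta (t s : R) : (f xi <= t%:E)%E -> (g eta <= s%:E)%E ->
    fv + gv <= t + s + dotv p (w - xi) + dotv y (A *m w - eta) + dotv z (B *m w - b).
  move=> fx gy; have := H w _ _ _ _ fx gy; rewrite addr0 -addrA -big_split /=.
  rewrite (eq_bigr (fun i => z i 0 * (B *m w - b) i 0)) // => i _.
  rewrite [z i 0]mxE /a /e; case: (u i 0 == 0); case: (pos); rewrite /= ?mulr0 ?mul0r; lra.
have zu : dotv z u = 0.
  by apply: big1 => i _; rewrite mxE; case: eqP => [->|_]; rewrite ?mulr0 ?mul0r.
have fxs' : (f xs <= fv%:E)%E by rewrite fxs.
have gxs' : (g (A *m xs) <= gv%:E)%E by rewrite gxs.
have sg_y eta (s : R) : (g eta <= s%:E)%E -> gv + dotv y (eta - A *m xs) <= s.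
  move=> /(H xs xs eta fv s fxs'); rewrite -/u zu subrr dotvBr.
  rewrite [dotv p 0](_ : _ = 0); last by apply: big1 => i _; rewrite mxE mulr0.
  by rewrite dotvBr; lra.
have sf_p xi (t : R) : (f xi <= t%:E)%E -> dotv p xi <= t + (dotv p xs - fv).
  move=> fx; have := H xs xi (A *m xs) t gv fx gxs'; rewrite -/u zu subrr.
  rewrite [dotv y 0](_ : _ = 0); last by apply: big1 => i _; rewrite mxE mulr0.
  by rewrite dotvBr; lra.
have pE : p = - (A^T *m y) - B^T *m z.
  apply/eqP; rewrite -subr_eq0; apply/eqP; apply: dotv_eq0 => w.
  apply: (@bounded_affine_slope0 R 0) => tau.
  have := H (xs + tau *: w) xs (A *m xs) fv gv fxs' gxs'.
  have -> : B *m (xs + tau *: w) - b = u + tau *: (B *m w).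
    by rewrite mulmxDr -scalemxAr addrAC.
  rewrite (dotvDr z u) zu mulmxDr -scalemxAr !(dotvBr _ (_ + _)) !dotvDr !dotvZr.
  by rewrite dotvBl dotvBl dotvNl !dotv_adj; lra.
have z0 : pos -> forall i, 0 <= z i 0.
  by move=> p1 i; rewrite mxE p1; case: ifP.
have fp : conj_fun f p = (dotv p xs - fv)%:E.
  by apply: le_anti; rewrite conj_fun_le//= conj_fun_lb// fxs.
have gy : conj_fun g y = (dotv y (A *m xs) - gv)%:E.
  apply: le_anti; rewrite conj_fun_lb// andbT conj_fun_le// => eta s /sg_y.
  by rewrite dotvBr; lra.
have XiE : Xi f g A B b y z = (- (fv + gv))%:E.
  rewrite /Xi -pE fp gy -!EFinD; congr EFin; move: zu; rewrite pE.
  by rewrite /u dotvBr dotvBl dotvNl !dotv_adj (dotvC b); lra.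
exists y, z; split.
- split=> [|eta]; first by rewrite gxs.
  rewrite gxs -EFinD; have := @sg_y eta; have := pg.1 eta.
  case: (g eta) => [v||] // _ h; last by rewrite leey.
  by rewrite lee_fin; apply: h.
- move=> i; case: eqVneq => [_|ui]; first by apply/implyP => /z0.
  by rewrite [z _ _]mxE (negbTE ui).
(* Within this radius nonzero coordinates of [z], where [u] vanishes, stay nonzero; a coordinate
   leaving zero pays [mu i], which dominates its share of the residual. *)
- pose h i := if z i 0 != 0 then `|z i 0| else mu i / (1 + `|u i 0|).
  have [|d d0 hd] := @finite_lower_bound R r h.
    move=> i; rewrite /h; case: ifP => [|_]; first by rewrite normr_gt0.
    by apply: divr_gt0 => //; have := normr_ge0 (u i 0); lra.
  exists d => // y' z' _ zz'; rewrite /Gobj XiE (Psi_fin mu z0).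
  have wd := @weak_duality R n m r f g A B b xs y' z' fv gv fxs' gxs'.
  apply: le_trans (leeD wd (lexx _)).
  have [/(Psi_ltey (mu := mu)) z'0|] := boolP (Psi pos mu z' < +oo)%E; last first.
    by rewrite -leNgt leye_eq => /eqP->; rewrite addey// leey.
  rewrite Psi_fin// -!EFinD lee_fin -/u -[X in X <= _]addr0 -!addrA lerD2l.
  rewrite addr0 addrC -sumrB; apply: ler_sum => i _.
  have := zz' i; have := hd i; rewrite /h.
  case: (eqVneq (z i 0) 0) => [->|zi] /=.
    rewrite subr0; case: (eqVneq (z' i 0) 0) => [->|_]; rewrite ?mul0r ?subr0//=.
    rewrite ler_pdivlMr; last by have := normr_ge0 (u i 0); lra.
    move=> h1 h2; rewrite subr_ge0; apply: le_trans (ler_norm _) _; rewrite normrM.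
    by have := normr_ge0 (u i 0); have := normr_ge0 (z' i 0); nra.
  have -> : u i 0 = 0 by apply/eqP; apply: contraNT zi => ui; rewrite [z _ _]mxE (negbTE ui).
  rewrite mulr0 subr0 => h1 h2; rewrite ifT//; apply/negP => /eqP z'i.
  by move: h2; rewrite z'i sub0r normrN ltNge h1.
- by rewrite XiE /Theta fxs gxs -EFinD -EFinN opprK.
Qed.

(** A short step towards a point supported in the support of [zs] creates no new nonzero coordinate
    and keeps positive ones nonnegative, so [Psi] does not increase and convexity of [Xi] does the
    rest. *)
Lemma dual_min_support (mu : 'I_r -> R) ys zs (fv gv : R) :
  (forall i, 0 < mu i) -> local_min2 (Gobj f g A B b pos mu) ys zs ->
  (pos -> forall i, 0 <= zs i 0) ->
  conj_fun f (- (A^T *m ys) - B^T *m zs) = fv%:E -> conj_fun g ys = gv%:E ->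
  forall y z (t s : R), (conj_fun f (- (A^T *m y) - B^T *m z)%R <= t%:E)%E ->
    (conj_fun g y <= s%:E)%E -> (forall i, zs i 0 = 0 -> z i 0 = 0) ->
    fv + gv + dotv b zs <= t + s + dotv b z.
Proof.
move=> mu0 [d d0 hd] zs0 fys gys y z t s fy gy zz.
pose h i := if zs i 0 == 0 then 1 else `|zs i 0|.
have [|k k0 hk] := @finite_lower_bound R r h.
  by move=> i; rewrite /h; case: eqVneq => // ui; rewrite normr_gt0.
have [e1 e10 he1] := @near_in_small R m ys (y - ys) d d0.
have [e2 e20 he2] := @near_in_small R r zs (z - zs) d d0.
have [e3 e30 he3] := @small_multiple R r (z - zs) k k0.
pose c := Num.min 1 (Num.min e1 (Num.min e2 e3)).
have c0 : 0 < c by rewrite !lt_min ltr01 e10 e20.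
have c1 : c <= 1 by rewrite ge_min lexx.
have ce1 : c <= e1 by rewrite !ge_min lexx orbT.
have ce2 : c <= e2 by rewrite !ge_min lexx !orbT.
have ce3 : c <= e3 by rewrite !ge_min lexx !orbT.
have := hd _ _ (he1 c (ltW c0) ce1) (he2 c (ltW c0) ce2).
set yc := ys + _; set zc := zs + _.
have zcE i : zc i 0 = zs i 0 + c * (z i 0 - zs i 0) by rewrite !mxE.
have zc0 : pos -> forall i, 0 <= zc i 0.
  move=> p1 i; have := he3 c (ltW c0) ce3 i; have := hk i; rewrite /h zcE !mxE.
  have := zs0 p1 i; have := zz i; case: (eqVneq (zs i 0) 0) => [-> /(_ erefl)->|zi _ zi0].
    by move=> *; lra.
  rewrite (ger0_norm zi0) => h1 h2; have := lt_le_trans h2 h1.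
  by rewrite -normrN => h3; have := le_lt_trans (ler_norm _) h3; lra.
have hPsi : (Psi pos mu zc <= Psi pos mu zs)%E.
  rewrite !Psi_fin// lee_fin; apply: ler_sum => i _; rewrite zcE.
  have := mu0 i; have := zz i; case: (eqVneq (zs i 0) 0) => [-> /(_ erefl)->|zi _].
    by rewrite subrr mulr0 addr0 eqxx.
  by case: ifP => //= _ /ltW.
have fyc : (conj_fun f (- (A^T *m yc) - B^T *m zc)%R <= (c * t + (1 - c) * fv)%:E)%E.
  rewrite (_ : - _ - _ = c *: (- (A^T *m y) - B^T *m z) + (1 - c) *: (- (A^T *m ys) - B^T *m zs)).
    by apply: (convex_conj_fun pf fy) => //; rewrite ?fys// ltW.
  by rewrite /yc /zc !mulmxDr -!scalemxAr !mulmxBr; apply/colP => i; rewrite !mxE; ring.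
have gyc : (conj_fun g yc <= (c * s + (1 - c) * gv)%:E)%E.
  rewrite (_ : yc = c *: y + (1 - c) *: ys).
    by apply: (convex_conj_fun pg gy) => //; rewrite ?gys// ltW.
  by apply/colP => i; rewrite !mxE; ring.
have bzc : dotv b zc = c * dotv b z + (1 - c) * dotv b zs.
  by rewrite dotvDr dotvZr dotvBr; ring.
move=> hG; have := le_trans hG (leeD (leeD (leeD fyc gyc) (lexx (dotv b zc)%:E)) hPsi).
rewrite /Gobj /Xi fys gys Psi_fin// -!EFinD lee_fin bzc; nra.
Qed.

Hypotheses (lf : lsc_fun f) (lg : lsc_fun g).

(** The multiplier of the equation for the argument of the conjugate of [f] is the primal point
    [xs]. Stationarity in [y] and [z] identifies the other two as [A *m xs] and [B *m xs - b], so
    the latter vanishes on the support of [zs]. *)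
Lemma dual_to_primal (lam mu : 'I_r -> R) ys zs :
  (forall i, 0 < lam i) -> (forall i, 0 < mu i) ->
  local_min2 (Gobj f g A B b pos mu) ys zs ->
  (Gobj f g A B b pos mu ys zs < +oo)%E ->
  (exists y z, [/\ slater_pt (conj_fun f) (- (A^T *m y) - B^T *m z),
                   slater_pt (conj_fun g) y & forall i, zs i 0 = 0 -> z i 0 = 0]) ->
  exists xs, [/\ csubdiff (conj_fun f) (- (A^T *m ys) - B^T *m zs) xs,
     local_min (Fobj f g A B b pos lam) xs &
     Theta f g A xs = (- Xi f g A B b ys zs)%E].
Proof.
move=> lam0 mu0 lmin Gfin [y0 [z0 [sf sg z0z]]].
have pcf := proper_conj_fun pf sf; have pcg := proper_conj_fun pg sg.
have ccf := convex_conj_fun pf; have ccg := convex_conj_fun pg.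
set qs := - (A^T *m ys) - B^T *m zs.
have [fv [gv [fys gys Pzs]]] : exists fv gv : R,
    [/\ conj_fun f qs = fv%:E, conj_fun g ys = gv%:E & (Psi pos mu zs < +oo)%E].
  have PN : Psi pos mu zs != -oo%E by rewrite /Psi; case: ifP.
  move: Gfin PN; rewrite /Gobj /Xi -/qs; have := pcf.1 qs; have := pcg.1 ys.
  case: (conj_fun f qs) => [fv||]//; case: (conj_fun g ys) => [gv||]//;
    case: (Psi pos mu zs) => [c||]// _ _ _ _.
  by exists fv, gv; rewrite ltry.
have zs0 := Psi_ltey Pzs.
have gmin := dual_min_support mu0 lmin zs0 fys gys.
set v := fv + gv + dotv b zs in gmin.
pose L (w : 'cV[R]_m * 'cV[R]_r) := - (A^T *m w.1) - B^T *m w.2.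
pose e (i : 'I_r) (w : 'cV[R]_m * 'cV[R]_r) := if zs i 0 == 0 then w.2 i 0 else 0.
have [|||||||xs [yy [l [k [_ H]]]]] := @fenchel_multipliers R ('cV[R]_m * 'cV[R]_r)%type n m 'I_0 'I_r
    (conj_fun f) (conj_fun g) L (fun w => w.1) (fun w => dotv b w.2) (fun _ _ => 0) e v (y0, z0)
    pcf ccf pcg ccg _ _ _ _ _ sf sg (fun=> lexx 0).
- by move=> i t x y; rewrite /L /= !mulmxDr -!scalemxAr !mxE; ring.
- by move=> i t x y; rewrite !mxE.
- by move=> t x y /=; rewrite dotvDr !dotvZr.
- by case.
- by move=> i t x y; rewrite /e; case: (zs i 0 == 0); rewrite /= ?mxE; ring.
- by move=> i; rewrite /e; case: eqP => // /z0z.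
- move=> [y z] t s fy gy _ ez; apply: gmin fy gy _ => i zi.
  by have := ez i; rewrite /e zi eqxx.
pose nu := \col_i (if zs i 0 == 0 then k i else 0).
have {}H y z xi eta (t s : R) : (conj_fun f xi <= t%:E)%E -> (conj_fun g eta <= s%:E)%E ->
    v <= t + s + dotv b z + dotv xs (- (A^T *m y) - B^T *m z - xi) + dotv yy (y - eta) + dotv nu z.
  move=> fx gy; have := H (y, z) _ _ _ _ fx gy; rewrite big_ord0 addr0 /=.
  rewrite [dotv nu z](eq_bigr (fun i => k i * e i (y, z)))// => i _.
  by rewrite mxE /e; case: (zs i 0 == 0); rewrite /= ?mulr0 ?mul0r.
have nuz : dotv nu zs = 0.
  by apply: big1 => i _; rewrite mxE; case: eqP => [->|_]; rewrite ?mulr0 ?mul0r.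
have fys' : (conj_fun f qs <= fv%:E)%E by rewrite fys.
have gys' : (conj_fun g ys <= gv%:E)%E by rewrite gys.
have dot0 q (x : 'cV[R]_q) : dotv x 0 = 0 by apply: big1 => i _; rewrite mxE mulr0.
have yyE : yy = A *m xs.
  apply/eqP; rewrite -subr_eq0; apply/eqP; apply: dotv_eq0 => w.
  apply: (@bounded_affine_slope0 R 0) => tau.
  have := H (ys + tau *: w) zs qs ys fv gv fys' gys'.
  have -> : - (A^T *m (ys + tau *: w)) - B^T *m zs - qs = - (tau *: (A^T *m w)).
    by rewrite /qs mulmxDr -scalemxAr; apply/colP => i; rewrite !mxE; ring.
  rewrite (addrAC ys) subrr add0r dotvNr !dotvZr nuz dotvBl (dotvC xs) dotv_adj (dotvC w) /v; lra.
have nuE : nu = B *m xs - b.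
  apply/eqP; rewrite -subr_eq0; apply/eqP; apply: dotv_eq0 => w.
  apply: (@bounded_affine_slope0 R 0) => tau.
  have := H ys (zs + tau *: w) qs ys fv gv fys' gys'.
  have -> : - (A^T *m ys) - B^T *m (zs + tau *: w) - qs = - (tau *: (B^T *m w)).
    by rewrite /qs mulmxDr -scalemxAr; apply/colP => i; rewrite !mxE; ring.
  rewrite subrr dot0 dotvNr !dotvDr !dotvZr nuz !dotvBl (dotvC xs) dotv_adj (dotvC w) /v; lra.
have sf_x xi (t : R) : (conj_fun f xi <= t%:E)%E -> fv + dotv xs (xi - qs) <= t.
  move=> fx; have := H ys zs xi ys t gv fx gys'.
  by rewrite -/qs subrr dot0 nuz !dotvBr /v; lra.
have sg_x eta (s : R) : (conj_fun g eta <= s%:E)%E -> gv + dotv (A *m xs) (eta - ys) <= s.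
  move=> gx; have := H ys zs qs eta fv s fys' gx.
  by rewrite -/qs subrr dot0 nuz yyE !dotvBr /v; lra.
(* Fenchel-Moreau gives the upper bound on [f xs], Fenchel-Young the lower one. *)
have fx : f xs = (dotv qs xs - fv)%:E.
  have fle : (f xs <= (dotv qs xs - fv)%:E)%E.
    by apply: biconj_le => // q s /sf_x; rewrite dotvBr !(dotvC xs); lra.
  have [fr fE] := proper_fin pf (le_lt_trans fle (ltry _)).
  move: fle; rewrite fE lee_fin => fle; congr EFin; apply/eqP; rewrite eq_le fle /=.
  have : (f xs <= fr%:E)%E by rewrite fE.
  by move=> /conj_fun_ge /(_ fys'); lra.
have gx : g (A *m xs) = (dotv ys (A *m xs) - gv)%:E.
  have gle : (g (A *m xs) <= (dotv ys (A *m xs) - gv)%:E)%E.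
    by apply: biconj_le => // q s /sg_x; rewrite dotvBr !(dotvC (A *m xs)); lra.
  have [gr gE] := proper_fin pg (le_lt_trans gle (ltry _)).
  move: gle; rewrite gE lee_fin => gle; congr EFin; apply/eqP; rewrite eq_le gle /=.
  have : (g (A *m xs) <= gr%:E)%E by rewrite gE.
  by move=> /conj_fun_ge /(_ gys'); lra.
have XiE : Xi f g A B b ys zs = v%:E by rewrite /Xi -/qs fys gys -!EFinD.
have ThE : Theta f g A xs = (- v)%:E.
  rewrite /Theta fx gx -EFinD; congr EFin; move: nuz; rewrite nuE dotvBl.
  by rewrite /qs dotvBl dotvNl !dotv_adj (dotvC zs) /v; lra.
exists xs; split.
- split=> [|xi]; first by rewrite fys.
  rewrite fys -EFinD; have := @sf_x xi; have := pcf.1 xi.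
  case: (conj_fun f xi) => [c||] // _ h; last by rewrite leey.
  by rewrite lee_fin; apply: h.
- pose u := B *m xs - b.
  pose h i := if zs i 0 != 0 then lam i / (1 + `|zs i 0|)
              else if u i 0 == 0 then 1 else `|u i 0|.
  have [|d d0 hd] := @finite_lower_bound R r h.
    move=> i; rewrite /h; case: ifP => [_|_].
      by apply: divr_gt0 => //; have := normr_ge0 (zs i 0); lra.
    by case: eqVneq => // ui; rewrite normr_gt0.
  have [e0 e00 he0] := @near_in_mulmx R n r B d d0.
  exists e0 => // x /he0 nx; rewrite /Fobj ThE.
  set u' := B *m x - b.
  (* The subtracted term is exactly the residual of weak duality, so this inequality implies local
     optimality. *)
  have hPhi : Phi pos lam u <= Phi pos lam u' - dotv zs u'.
    rewrite /Phi /dotv -sumrB; apply: ler_sum => i _.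
    have {nx} : `|u' i 0 - u i 0| < d.
      by have := nx i; rewrite (_ : _ - _ = u' i 0 - u i 0)//; rewrite /u /u' !mxE; ring.
    have := hd i; have := zs0; have l0 := lam0 i; rewrite /h.
    case: (eqVneq (zs i 0) 0) => [->|zi] /=.
      rewrite mul0r subr0 => _; case: (eqVneq (u i 0) 0) => [->|ui] h1 h2.
        by rewrite ltxx if_same; case: ifP => // _; apply: ltW.
      have := lt_le_trans h2 h1 => h3; case: (pos).
        case: ifP => [u0|_]; last by case: ifP => // _; apply: ltW.
        rewrite ifT//; rewrite (gtr0_norm u0) -normrN in h3.
        by have := le_lt_trans (ler_norm _) h3; lra.
      rewrite ifT//; apply/negP => /eqP u'i.
      by move: h3; rewrite u'i sub0r normrN ltxx.
    have -> : u i 0 = 0 by rewrite /u -nuE mxE (negbTE zi).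
    rewrite subr0 ltxx eqxx if_same ler_pdivlMr; last by have := normr_ge0 (zs i 0); lra.
    move=> zp h1 h2.
    (* A penalized departure from zero is paid for by [lam i]; an unpenalized one to the negative
       side makes the product nonpositive, as [zs i 0 >= 0]. *)
    have h3 : zs i 0 * u' i 0 <= lam i.
      apply: le_trans (ler_norm _) _; rewrite normrM.
      by have := normr_ge0 (zs i 0); have := normr_ge0 (u' i 0); nra.
    case: (boolP pos) => p1.
      have zi0 : 0 <= zs i 0 by apply: zp.
      by case: ltP => u'0; rewrite subr_ge0//; nra.
    by case: eqVneq => [->|_]; rewrite ?mulr0 subr_ge0.
  have := @weak_duality R n m r f g A B b x ys zs; rewrite XiE -/u' /Theta.
  have := pf.1 x; have := pg.1 (A *m x).
  case: (f x) => [c||]//; case: (g _) => [c'||]//; rewrite ?leey//= => _ _ wd.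
  have := wd c c' (lexx _) (lexx _); rewrite -!EFinD !lee_fin -/u; lra.
- by rewrite ThE XiE -EFinN.
Qed.

End Duality.

(* pos = true : pair (Phi_{+,lam}, Psi_{+,mu});  pos = false : pair (Phi_{0,lam}, Psi_{0,mu}) *)
Theorem mainTheorem17 (R : realType) (n m r : nat)
  (f : 'cV[R]_n -> \bar R) (g : 'cV[R]_m -> \bar R)
  (A : 'M[R]_(m, n)) (B : 'M[R]_(r, n)) (b : 'cV[R]_r)
  (pos : bool) (lam mu : 'I_r -> R) :
  proper_fun f -> lsc_fun f -> convex_fun f ->
  proper_fun g -> lsc_fun g -> convex_fun g ->
  (forall i, 0 < lam i) -> (forall i, 0 < mu i) ->
  (* (i) *)
  (forall xs : 'cV[R]_n,
     local_min (Fobj f g A B b pos lam) xs ->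
     (Fobj f g A B b pos lam xs < +oo)%E ->
     (exists x : 'cV[R]_n,
        [/\ slater_pt f x, slater_pt g (A *m x) &
            forall i, (B *m xs - b) i 0 = 0 ->
              if pos then (B *m x - b) i 0 <= 0 else (B *m x - b) i 0 == 0]) ->
     exists (ys : 'cV[R]_m) (zs : 'cV[R]_r),
       [/\ csubdiff g (A *m xs) ys,
           subdiffPhi pos (B *m xs - b) zs,
           local_min2 (Gobj f g A B b pos mu) ys zs &
           Theta f g A xs = (- Xi f g A B b ys zs)%E])
  /\
  (* (ii) *)
  (forall (ys : 'cV[R]_m) (zs : 'cV[R]_r),
     local_min2 (Gobj f g A B b pos mu) ys zs ->
     (Gobj f g A B b pos mu ys zs < +oo)%E ->
     (exists (y : 'cV[R]_m) (z : 'cV[R]_r),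
        [/\ slater_pt (conj_fun f) (- (A^T *m y) - B^T *m z),
            slater_pt (conj_fun g) y,
            (forall i, zs i 0 = 0 -> z i 0 = 0) &
            (pos -> forall i, zs i 0 != 0 -> 0 <= z i 0)]) ->
     exists xs : 'cV[R]_n,
       [/\ csubdiff (conj_fun f) (- (A^T *m ys) - B^T *m zs) xs,
           local_min (Fobj f g A B b pos lam) xs &
           Theta f g A xs = (- Xi f g A B b ys zs)%E]).
Proof.
move=> pf lf cf pg lg cg lam0 mu0; split=> [xs lmin Ffin slater|ys zs lmin Gfin].
  exact: (primal_to_dual pf cf pg cg lam0 mu0 lmin Ffin slater).
move=> [y [z [sf sg zz _]]]; apply: (dual_to_primal pf cf pg cg lf lg lam0 mu0 lmin Gfin).
by exists y, z.
Qed.
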